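(* Let $R(x,y)$ and $S(z,y)$ be binary relations of size $N$, and let $W$ be a workload of boolean queries of the form $Q_{ab}() = R(a,y), S(b,y)$, parametrized by pairs of constants $(a,b)$, arriving at the rate of $B$ access requests per second. Assume that the exponent of matrix multiplication is $\omega = 2$. Then the workload can be serviced with an average latency of $O(N^{3/5}/B^{2/5})$ using $\rho = (B\cdot N)^{3/5}$ machines.
   Context: Boolean set intersection: $R(x,y)$ means that set $x$ contains element $y$, and $S(z,y)$ means that set $z$ contains element $y$. The query $Q_{ab}()$ asks whether there is a value $y$ with $(a,y)\in R$ and $(b,y)\in S$, i.e. whether sets $a$ and $b$ intersect. Service model: queries arrive at a rate of $B$ queries per time unit (second) and may be serviced using multiple machines. Queries may be answered one at a time, or batched: for a batch size $C$, the pairs $(a,b)$ of $C$ consecutive requests form a relation $T(x,z)$ of size $C$, and all of them are answered at once by computing $Q_{batch}(x,z) = R(x,y), S(z,y), T(x,z)$ (the set of pairs $(x,z)\in T$ for which some $y$ satisfies $(x,y)\in R$ and $(z,y)\in S$). The average latency is the average time to answer each query; if a batch of $C$ queries is processed in time $t(C)$, it is accounted as $\frac{C}{B} + \frac{t(C)}{C}$ (time to collect the batch plus processing time per query). The number of machines needed to keep up with the workload is accounted as $\rho = B\cdot \frac{t(C)}{C}$, up to constant factors (for example, answering each query separately, in time $O(N)$, needs $B\cdot N$ machines). Running times are measured in the uniform-cost RAM model, where data values and pointers have constant size. The assumption that the matrix multiplication exponent is $\omega$ means that two $n\times n$ matrices can be multiplied in time $O(n^{\omega})$; then a $U\times V$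 matrix and a $V\times W$ matrix can be multiplied in time $O(UVW\beta^{\omega-3})$ with $\beta=\min\{U,V,W\}$.
   Formalization: The claim is proved for 1 ≤ (B·N)^{3/5} ≤ N, i.e. 1/N ≤ B ≤ N^{2/3}; uniformly in B and N it fails otherwise, e.g. as B·N → 0 (latency is at least 1/B) or for B far above N^{3/2} (the bound tends to 0). *)

(* Defs.v *)
(* MathComp and MathComp-Analysis; the real numbers are an arbitrary realType. *)
From HB Require Import structures.
From mathcomp Require Import all_boot all_order all_algebra.
From mathcomp Require Import reals exp.
Set Implicit Arguments.
Unset Strict Implicit.
Unset Printing Implicit Defensive.
Import Order.TTheory GRing.Theory Num.Theory.
Local Open Scope ring_scope.

(* Uniform-cost random access machine, programmed by while-programs: finitely
   many registers and finitely many arrays occur in a program (both are named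
   by natural numbers), and every cell holds one word.  Jumping programs are
   simulated by while-programs with constant overhead, and one linear memory by
   interleaving the arrays, so time bounds up to constant factors are those of
   the usual RAM. *)
Inductive binop := Add | Sub | Mul | Div | Less | Equal.

Inductive expr :=
| Cst of int
| Reg of nat
| Get of nat & expr
| Bin of binop & expr & expr.

Inductive cmd :=
| Skip
| Assign of nat & expr
| Store of nat & expr & expr
| Seq of cmd & cmd
| If of expr & cmd & cmd
| While of expr & cmd.

Record state := State { reg : nat -> int; mem : nat -> int -> int }.

Definition set_reg (st : state) (x : nat) (v : int) : state :=
  State (fun y => if y == x then v else reg st y) (mem st).

Definition set_mem (st : state) (a : nat) (i v : int) : state :=
  State (reg st)
        (fun b j => if (b == a) && (j == i) then v else mem st b j).

Definition eval_op (o : binop) (u v : int) : int :=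
  match o with
  | Add => u + v
  | Sub => u - v
  | Mul => u * v
  | Div => (u %/ v)%Z
  | Less => Posz (u < v)%R
  | Equal => Posz (u == v)%R
  end.

Fixpoint eval (st : state) (e : expr) : int :=
  match e with
  | Cst c => c
  | Reg x => reg st x
  | Get a e1 => mem st a (eval st e1)
  | Bin o e1 e2 => eval_op o (eval st e1) (eval st e2)
  end.

(* [fits M st e]: every value met while evaluating [e], array indices included,
   is a word, i.e. has absolute value at most M. *)
Fixpoint fits (M : nat) (st : state) (e : expr) : bool :=
  (`|eval st e| <= M)%N &&
  match e with
  | Get _ e1 => fits M st e1
  | Bin _ e1 e2 => fits M st e1 && fits M st e2
  | _ => true
  end.

Fixpoint cost (e : expr) : nat :=
  match e with
  | Get _ e1 => (cost e1).+1
  | Bin _ e1 e2 => (cost e1 + cost e2).+1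
  | _ => 1
  end.

(* [exec M c st n st']: [c] started in [st] halts in [st'] after n steps.
   There is no rule for an overflow: a computation producing a value that is
   not a word has no execution, so unbounded integers cannot be used to pack
   many data values into a single cell. *)
Inductive exec (M : nat) : cmd -> state -> nat -> state -> Prop :=
| ExecSkip st : exec M Skip st 1 st
| ExecAssign st x e :
    fits M st e ->
    exec M (Assign x e) st (cost e).+1 (set_reg st x (eval st e))
| ExecStore st a e1 e2 :
    fits M st e1 -> fits M st e2 ->
    exec M (Store a e1 e2) st (cost e1 + cost e2).+1
         (set_mem st a (eval st e1) (eval st e2))
| ExecSeq st1 st2 st3 c1 c2 n1 n2 :
    exec M c1 st1 n1 st2 -> exec M c2 st2 n2 st3 ->
    exec M (Seq c1 c2) st1 (n1 + n2) st3
| ExecIfTrue st st' e c1 c2 n :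
    fits M st e -> eval st e != 0 -> exec M c1 st n st' ->
    exec M (If e c1 c2) st ((cost e).+1 + n) st'
| ExecIfFalse st st' e c1 c2 n :
    fits M st e -> eval st e = 0 -> exec M c2 st n st' ->
    exec M (If e c1 c2) st ((cost e).+1 + n) st'
| ExecWhileTrue st1 st2 st3 e c n1 n2 :
    fits M st1 e -> eval st1 e != 0 ->
    exec M c st1 n1 st2 -> exec M (While e c) st2 n2 st3 ->
    exec M (While e c) st1 ((cost e).+1 + n1 + n2) st3
| ExecWhileFalse st e c :
    fits M st e -> eval st e = 0 -> exec M (While e c) st (cost e).+1 st.

(* Inputs: register x starts with the x-th element of [rs], array a with the
   a-th element of [arrs]; all the other cells start with 0. *)
Definition init (rs : seq int) (arrs : seq (seq int)) : state :=
  State (fun x => nth 0 rs x)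
        (fun a i => if i is Posz j then nth 0 (nth [::] arrs a) j else 0).

(* Words have O(log m) bits, with m the largest absolute value in the input.
   The input sizes are always passed in registers, hence are at most m. *)
Definition word_bound (k : nat) (rs : seq int) (arrs : seq (seq int)) : nat :=
  ((\max_(v <- rs ++ flatten arrs) `|v|%N) + 2) ^ k.

Definition runs_within (R : realType) (p : cmd) (k : nat)
    (rs : seq int) (arrs : seq (seq int)) (t : R) (post : state -> Prop) : Prop :=
  exists (n : nat) (st : state),
    [/\ exec (word_bound k rs arrs) p (init rs arrs) n st, n%:R <= t & post st].

Definition row_major (n : nat) (A : 'M[int]_n) : seq int :=
  [seq A i j | i <- enum 'I_n, j <- enum 'I_n].

(* One program multiplies all pairs of n x n integer matrices in time
   O(n^omega).  The case n = 0 is excluded because the bound is then 0. *)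
Definition matmul_exponent (R : realType) (omega : R) : Prop :=
  exists (p : cmd) (k : nat) (K : R),
    forall (n : nat) (A B : 'M[int]_n), (0 < n)%N ->
      runs_within p k [:: Posz n] [:: row_major A; row_major B]
        (K * n%:R `^ omega)
        (fun st => forall i j : 'I_n,
           mem st 2 (Posz (i * n + j)) = (A *m B) i j).

(* Data values are natural numbers; a binary relation is a duplicate-free
   sequence of pairs, listed in an arbitrary order. *)
Definition Q (Rxy Szy : seq (nat * nat)) (a b : nat) : Prop :=
  exists y : nat, (a, y) \in Rxy /\ (b, y) \in Szy.

Definition firsts (s : seq (nat * nat)) : seq int := [seq Posz q.1 | q <- s].
Definition seconds (s : seq (nat * nat)) : seq int := [seq Posz q.2 | q <- s].

(* [p] answers the requests T, given in order of arrival and possibly with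
   repetitions: cell i of array 6 tells whether the i-th pair of T belongs to
   Q_batch(x,z) = R(x,y), S(z,y), T(x,z).  The time includes any indexing
   of R and S. *)
Definition answers_batch (R : realType) (p : cmd) (k : nat)
    (Rxy Szy T : seq (nat * nat)) (t : R) : Prop :=
  runs_within p k
    [:: Posz (size Rxy); Posz (size Szy); Posz (size T)]
    [:: firsts Rxy; seconds Rxy; firsts Szy; seconds Szy; firsts T; seconds T]
    t
    (fun st => forall i : nat, (i < size T)%N ->
       exists2 b : bool, mem st 6 (Posz i) = Posz b &
         (b <-> Q Rxy Szy (nth (0, 0)%N T i).1 (nth (0, 0)%N T i).2)).

(* The j-th group of C consecutive requests of the workload W. *)
Definition batch (W : nat -> nat * nat) (C j : nat) : seq (nat * nat) :=
  [seq W (j * C + i)%N | i <- iota 0 C].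

Definition batch_latency (R : realType) (B : R) (C : nat) (t : R) : R :=
  C%:R / B + t / C%:R.

Definition batch_machines (R : realType) (B : R) (C : nat) (t : R) : R :=
  B * (t / C%:R).

(* With C = 1 the requests are answered one at a time. *)
Definition serviced (R : realType) (p : cmd) (k : nat)
    (Rxy Szy : seq (nat * nat)) (W : nat -> nat * nat) (B : R)
    (latency machines : R) : Prop :=
  exists (C : nat) (t : R),
    [/\ (0 < C)%N,
        forall j : nat, answers_batch p k Rxy Szy (batch W C j) t,
        batch_latency B C t <= latency &
        batch_machines B C t <= machines].

(* Main.v *)
(** With C the integer part of (B N)^(3/5), it suffices to answer a batch of C
    requests (x, z) in time O(N C^(1/3)).  Let d be the least integer with
    C <= d^3, and call a set heavy if it has more than N / d^2 elements; there
    are fewer than n = d^2 heavy sets on each side.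
    - If x or z is light, its elements are enumerated and looked up in the other
      set, at a cost of N / d^2 per request.
    - Common elements y that belong to fewer than d sets z are found by listing,
      for each pair (x, y) of R, the sets z that contain y: N d steps.
    - At most N / d values y remain.  They are spread over L = N / d^3 + 1 blocks
      of n values, and for each block two n x n boolean matrices (heavy x against
      y, y against heavy z) are multiplied, in time O(L n^2) = O(N d) when
      omega = 2.  A request between heavy sets reads one entry of each product.
    Arrays are indexed directly by data values, and a pair (x, y) by the
    injective code (x + y)^2 + y, so no hashing or sorting is needed.  The given
    multiplication program must start from fresh memory in every call; the calls
    therefore run on interleaved copies of its memory. *)
From mathcomp Require Import all_boot all_order all_algebra.
From mathcomp Require Import boolp reals exp.
From mathcomp Require Import zify ring lra.
Require Import Defs.
Set Implicit Arguments.
Unset Strict Implicit.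
Unset Printing Implicit Defensive.
Import Order.TTheory GRing.Theory Num.Theory.

(** * Timed execution and loops *)

Fixpoint wr (c : cmd) (x : nat) : bool :=
  match c with
  | Skip | Store _ _ _ => false
  | Assign y _ => x == y
  | Seq c1 c2 | If _ c1 c2 => wr c1 x || wr c2 x
  | While _ c1 => wr c1 x
  end.

Fixpoint wa (c : cmd) (a : nat) : bool :=
  match c with
  | Skip | Assign _ _ => false
  | Store b _ _ => a == b
  | Seq c1 c2 | If _ c1 c2 => wa c1 a || wa c2 a
  | While _ c1 => wa c1 a
  end.

Definition frame (c : cmd) (s s' : state) : Prop :=
  (forall x, ~~ wr c x -> reg s' x = reg s x) /\
  (forall a, ~~ wa c a -> mem s' a = mem s a).

Lemma set_mem_other (s : state) (a b : nat) (i v : int) :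
  b != a -> mem (set_mem s a i v) b = mem s b.
Proof. by move=> /negbTE ba; apply/funext => j /=; rewrite ba. Qed.

(** A syntactic over-approximation of the written cells is enough: [wr] and [wa] compute, so later
    phases recover untouched inputs and parameters by simplification. *)
Lemma exec_frame (M : nat) (c : cmd) (s s' : state) (n : nat) :
  exec M c s n s' -> frame c s s'.
Proof.
elim=> {c s s' n} //=.
- by move=> st x e _; split=> //= y /negbTE /= ->.
- by move=> st a e1 e2 _ _; split=> // b ba; exact: set_mem_other.
- move=> st1 st2 st3 c1 c2 n1 n2 _ [r1 m1] _ [r2 m2]; split=> x /=;
    rewrite negb_or => /andP[h1 h2]; first by rewrite r2 // r1.
  by rewrite m2 // m1.
- move=> st st' e c1 c2 n _ _ _ [r1 m1]; split=> x /=;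
    rewrite negb_or => /andP[h1 h2]; [exact: r1|exact: m1].
- move=> st st' e c1 c2 n _ _ _ [r1 m1]; split=> x /=;
    rewrite negb_or => /andP[h1 h2]; [exact: r1|exact: m1].
move=> st1 st2 st3 e c n1 n2 _ _ _ [r1 m1] _ [r2 m2]; split=> x /= h.
  by rewrite r2 // r1.
by rewrite m2 // m1.
Qed.

(* A value computed by [e] from cells bounded by [u] is at most [u ^ edeg e].
   The largest degree in the program is 7, that of the code of (x, y + 1). *)
Fixpoint edeg (e : expr) : nat :=
  match e with
  | Cst _ | Reg _ | Get _ _ => 1
  | Bin o e1 e2 =>
    match o with
    | Add | Sub => (maxn (edeg e1) (edeg e2)).+1
    | Mul => edeg e1 + edeg e2
    | Div => edeg e1
    | Less | Equal => 1
    end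
  end.

(** Degrees are checked at every node because [fits] bounds all intermediate values. Constants of
    absolute value at most 1 stay below any [u > 1]. *)
Fixpoint low (d : nat) (e : expr) : bool :=
  (edeg e <= d) &&
  match e with
  | Cst c => `|c| <= 1
  | Reg _ => true
  | Get _ e1 => low d e1
  | Bin _ e1 e2 => low d e1 && low d e2
  end.

Lemma low_edeg (d : nat) (e : expr) : low d e -> edeg e <= d.
Proof.
by case: e => [c|x|a e|o e1 e2]; case/andP.
Qed.

(** * Timed triples under a word bound *)

Section Triples.

Variables M u : nat.
Hypotheses (u_gt1 : 1 < u) (uM : u ^ 8 <= M).

(** Stored values are at most [u], while words reach at least [u ^ 8]. Addresses such as pair codes,
    which are never stored, thus fit in a word by a degree count. *)
Definition wf (s : state) : Prop :=
  (forall x, `|reg s x| <= u) /\ (forall a i, `|mem s a i| <= u).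

Lemma eval_bound (s : state) (d : nat) (e : expr) :
  wf s -> low d e -> `|eval s e| <= u ^ edeg e.
Proof.
move=> [wr_ wm]; elim: e => //=.
- by move=> c /andP[_ c1]; rewrite expn1 (leq_trans c1) // ltnW.
have up m k : m <= k -> u ^ m <= u ^ k by move=> mk; rewrite leq_pexp2l // ltnW.
move=> o e1 IH1 e2 IH2 /and3P[_ /IH1 h1 /IH2 h2].
(* Two terms bounded by [u ^ m] add up to at most [2 * u ^ m <= u ^ m.+1], whence the successor in
   [edeg] for sums and differences. *)
have half v w : v <= u ^ edeg e1 -> w <= u ^ edeg e2 ->
    v + w <= u ^ (maxn (edeg e1) (edeg e2)).+1.
  move=> hv hw; apply: (@leq_trans (2 * u ^ maxn (edeg e1) (edeg e2))).
    rewrite mul2n -addnn leq_add //.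
      by rewrite (leq_trans hv) // up // leq_maxl.
    by rewrite (leq_trans hw) // up // leq_maxr.
  by rewrite expnS leq_mul2r u_gt1 orbT.
case: o => /=.
- by apply: leq_trans (half _ _ h1 h2); lia.
- by apply: leq_trans (half _ _ h1 h2); lia.
- by rewrite abszM expnD leq_mul.
- by apply: leq_trans h1; have := lez_div (eval s e1) (eval s e2); lia.
- by rewrite expn1; case: (_ < _)%R => //=; lia.
- by rewrite expn1; case: (_ == _) => //=; lia.
Qed.

Lemma low_fits (s : state) (e : expr) : wf s -> low 8 e -> fits M s e.
Proof.
move=> ws.
have small e1 : low 8 e1 -> `|eval s e1| <= M.
  move=> l; apply: (leq_trans _ uM); apply: (leq_trans (eval_bound ws l)).
  by rewrite leq_pexp2l ?(low_edeg l) // ltnW.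
elim: e => [c|x|a e IH|o e1 IH1 e2 IH2] l; have := small _ l; move: l => /= l -> //=; move: l.
  exact: IH.
by case/and3P=> _ /IH1 -> /IH2 ->.
Qed.

(** Total correctness: the execution has to exist, so in particular it never overflows. *)
Definition run (c : cmd) (t : nat) (s : state) (Q : state -> Prop) : Prop :=
  exists n s', [/\ exec M c s n s', n <= t, wf s' & Q s'].

Lemma run_frame (c : cmd) (t : nat) (s : state) (Q : state -> Prop) :
  run c t s Q -> run c t s (fun s' => frame c s s' /\ Q s').
Proof.
by case=> n [s' [e nt w q]]; exists n, s'; split=> //; split=> //; exact: exec_frame e.
Qed.

Lemma run_weaken (c : cmd) (t t' : nat) (s : state) (P Q : state -> Prop) :
  run c t s P -> t <= t' -> (forall s', wf s' -> frame c s s' -> P s' -> Q s') ->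
  run c t' s Q.
Proof.
move=> /run_frame[n [s' [e nt w [f p]]]] tt' PQ; exists n, s'; split=> //.
  exact: leq_trans nt tt'.
exact: PQ.
Qed.

Lemma run_skip (s : state) (Q : state -> Prop) : wf s -> Q s -> run Skip 1 s Q.
Proof. by move=> w q; exists 1, s; split=> //; constructor. Qed.

Lemma run_seq (c1 c2 : cmd) (t1 t2 : nat) (s : state) (P Q : state -> Prop) :
  run c1 t1 s P ->
  (forall s', wf s' -> frame c1 s s' -> P s' -> run c2 t2 s' Q) ->
  run (Seq c1 c2) (t1 + t2) s Q.
Proof.
move=> /run_frame[n1 [s1 [e1 l1 w1 [f1 p1]]]] /(_ s1 w1 f1 p1) [n2 [s2 [e2 l2 w2 q2]]].
by exists (n1 + n2), s2; split=> //; [exact: ExecSeq e1 e2|rewrite leq_add].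
Qed.

Lemma wf_set_reg (s : state) (x : nat) (v : int) :
  wf s -> `|v| <= u -> wf (set_reg s x v).
Proof. by move=> [w1 w2] vu; split=> //= y; case: ifP. Qed.

Lemma wf_set_mem (s : state) (a : nat) (i v : int) :
  wf s -> `|v| <= u -> wf (set_mem s a i v).
Proof. by move=> [w1 w2] vu; split=> //= b j; case: ifP. Qed.

Lemma run_assign (x : nat) (e : expr) (s : state) (Q : state -> Prop) :
  wf s -> low 8 e -> `|eval s e| <= u -> Q (set_reg s x (eval s e)) ->
  run (Assign x e) (cost e).+1 s Q.
Proof.
move=> w le8 eu q; exists (cost e).+1, (set_reg s x (eval s e)); split=> //.
  by constructor; exact: low_fits.
exact: wf_set_reg.
Qed.

Lemma run_store (a : nat) (e1 e2 : expr) (s : state) (Q : state -> Prop) :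
  wf s -> low 8 e1 -> low 8 e2 -> `|eval s e2| <= u ->
  Q (set_mem s a (eval s e1) (eval s e2)) ->
  run (Store a e1 e2) (cost e1 + cost e2).+1 s Q.
Proof.
move=> w l1 l2 eu q.
exists (cost e1 + cost e2).+1, (set_mem s a (eval s e1) (eval s e2)); split=> //.
  by constructor; exact: low_fits.
exact: wf_set_mem.
Qed.

Lemma run_if (e : expr) (c1 c2 : cmd) (t : nat) (s : state) (Q : state -> Prop) :
  wf s -> low 8 e ->
  (eval s e != 0%R -> run c1 t s Q) -> (eval s e = 0%R -> run c2 t s Q) ->
  run (If e c1 c2) ((cost e).+1 + t) s Q.
Proof.
move=> w l h1 h2; have fe := low_fits w l.
case: (eqVneq (eval s e) 0%R) => [e0|e0].
  have [n [s' [ex nt w' q]]] := h2 e0.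
  by exists ((cost e).+1 + n), s'; split=> //; [exact: ExecIfFalse|rewrite leq_add2l].
have [n [s' [ex nt w' q]]] := h1 e0.
by exists ((cost e).+1 + n), s'; split=> //; [exact: ExecIfTrue|rewrite leq_add2l].
Qed.

Definition For (x y : nat) (c : cmd) : cmd :=
  Seq (Assign x (Cst 0))
      (While (Bin Less (Reg x) (Reg y))
             (Seq c (Assign x (Bin Add (Reg x) (Cst 1))))).

(** A round pays [t] for the body, 4 for the test and 4 for the increment; the last 6 steps are the
    initial assignment and the failing test. The invariant sees only the memory, since the registers
    that the body reads are recovered from the frame. *)
Lemma run_for (x y : nat) (c : cmd) (n t : nat)
    (I : nat -> (nat -> int -> int) -> Prop) (s : state) :
  wf s -> x != y -> ~~ wr c x -> ~~ wr c y -> reg s y = Posz n -> I 0 (mem s) ->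
  (forall i s', i < n -> wf s' -> frame (For x y c) s s' -> reg s' x = Posz i ->
     I i (mem s') -> run c t s' (fun s'' => I i.+1 (mem s''))) ->
  run (For x y c) (n * (t + 8) + 6) s (fun s' => I n (mem s')).
Proof.
move=> w xy cx cy sy I0 step.
have loop : forall k i s1, i + k = n -> wf s1 -> frame (For x y c) s s1 ->
    reg s1 x = Posz i -> I i (mem s1) ->
    run (While (Bin Less (Reg x) (Reg y)) (Seq c (Assign x (Bin Add (Reg x) (Cst 1)))))
        (k * (t + 8) + 4) s1 (fun s' => I n (mem s')).
  elim=> [|k IH] i s1 ik w1 f1 x1 I1.
    have test : eval s1 (Bin Less (Reg x) (Reg y)) = 0%R.
      rewrite /= x1 f1.1 /= ?(negbTE cy) ?sy; last by rewrite eq_sym (negbTE xy).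
      by rewrite ltz_nat -ik addn0 ltnn.
    exists 4, s1; split=> //; last by rewrite -ik addn0.
    by apply: (@ExecWhileFalse M s1 (Bin Less _ _)) => //; exact: low_fits.
  have lt_in : i < n by rewrite -ik addnS ltnS leq_addr.
  have y1 : reg s1 y = Posz n.
    by rewrite f1.1 /= ?(negbTE cy) ?sy; last by rewrite eq_sym (negbTE xy).
  have [n2 [s2 [e2 l2 w2 [f2 I2]]]] := run_frame (step i s1 lt_in w1 f1 x1 I1).
  have x2 : reg s2 x = Posz i by rewrite f2.1.
  pose s3 := set_reg s2 x (Posz i.+1).
  have w3 : wf s3.
    (* The counter never exceeds [n], which is held by register [y] and is therefore at most [u]. *)
    by apply: wf_set_reg => //; apply: leq_trans (w1.1 y); rewrite y1.
  have e3 : exec M (Assign x (Bin Add (Reg x) (Cst 1))) s2 4 s3.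
    have -> : s3 = set_reg s2 x (eval s2 (Bin Add (Reg x) (Cst 1))).
      by rewrite /= x2 /s3; congr set_reg; rewrite -addn1 PoszD.
    by apply: ExecAssign; exact: low_fits.
  have f3 : frame (For x y c) s s3.
    split=> [z|a] /= h.
      move: (h); rewrite !negb_or => /and3P[/negbTE zx cz _]; rewrite zx.
      by rewrite f2.1 // f1.1.
    by rewrite f2.2 ?f1.2 //; move: h; rewrite /= orbF.
  have x3 : reg s3 x = Posz i.+1 by rewrite /= eqxx.
  have [|n4 [s4 [e4 l4 w4 q4]]] := IH i.+1 s3 _ w3 f3 x3 I2; first by lia.
  exists ((cost (Bin Less (Reg x) (Reg y))).+1 + (n2 + 4) + n4), s4; split=> //.
    apply: ExecWhileTrue (ExecSeq e2 e3) e4; first exact: low_fits.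
    by rewrite /= x1 y1 ltz_nat lt_in.
  by rewrite /=; lia.
have -> : n * (t + 8) + 6 = 2 + (n * (t + 8) + 4) by lia.
apply: (run_seq (P := fun s1 => s1 = set_reg s x 0%R)).
  by apply: run_assign => //=; lia.
move=> s1 w1 _ ->; apply: (loop n 0) => //.
- exact: wf_set_reg.
- split=> // z /=; rewrite !negb_or => /and3P[/negbTE -> //].
- by rewrite /= eqxx.
Qed.

End Triples.

(** * Indexing a relation by one of its columns *)

Definition pr (x y : nat) : nat := (x + y) * (x + y) + y.

Definition pairE (e1 e2 : expr) : expr :=
  Bin Add (Bin Mul (Bin Add e1 e2) (Bin Add e1 e2)) e2.

(** As y <= x + y, the code is at least (x + y)^2 and less than (x + y + 1)^2, so it determines x +
    y and then y. *)
Lemma pr_inj (x y x' y' : nat) : pr x y = pr x' y' -> x = x' /\ y = y'.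
Proof.
rewrite /pr => e; suff xy : x + y = x' + y' by move: e; rewrite xy; lia.
by case: (ltngtP (x + y) (x' + y')) => // h; nia.
Qed.

Lemma pr_eq (x y x' y' : nat) :
  (Posz (pr x y) == Posz (pr x' y')) = (x == x') && (y == y').
Proof. by apply/eqP/andP => [[/pr_inj[-> ->]]|[/eqP-> /eqP->]]. Qed.

(* The values are shifted by one, because an empty cell reads 0. *)
Definition vals (l : seq (nat * nat)) (x : nat) : seq nat :=
  [seq q.2.+1 | q <- l & q.1 == x].

Lemma vals_rcons (l : seq (nat * nat)) (q : nat * nat) (x : nat) :
  vals (rcons l q) x = if x == q.1 then rcons (vals l x) q.2.+1 else vals l x.
Proof.
by rewrite /vals filter_rcons (eq_sym x); case: eqP => // _; rewrite map_rcons.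
Qed.

Lemma mem_vals (l : seq (nat * nat)) (x v : nat) :
  (v \in vals l x) = (0 < v) && ((x, v.-1) \in l).
Proof.
apply/mapP/andP => [[[x' y]]|[v0 h]].
  by rewrite mem_filter /= => /andP[/eqP-> h] ->.
by exists (x, v.-1); rewrite ?mem_filter /= ?eqxx // prednK.
Qed.

(** A pair of [l] is counted under at most one key, because [hs] has no duplicates. *)
Lemma sum_size_vals (l : seq (nat * nat)) (hs : seq nat) :
  uniq hs -> \sum_(x <- hs) size (vals l x) <= size l.
Proof.
move=> uh; elim: l => [|q l IH] /=; first by rewrite big1_seq.
rewrite (eq_bigr (fun x => (q.1 == x) + size (vals l x))); last first.
  by move=> x _; rewrite /vals /=; case: ifP.
rewrite big_split /= -add1n leq_add //.
have -> : \sum_(x <- hs) (q.1 == x : nat) = count_mem q.1 hs.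
  by rewrite -sum1_count [RHS]big_mkcond; apply: eq_bigr => x _; rewrite /= eq_sym; case: eqP.
by rewrite count_uniq_mem // leq_b1.
Qed.

(** Markov's inequality for degrees; it bounds the number of heavy keys, hence the range of their
    identifiers. *)
Lemma heavy_count (l : seq (nat * nat)) (hs : seq nat) (t : nat) :
  uniq hs -> (forall x, x \in hs -> t <= size (vals l x)) ->
  t * size hs <= size l.
Proof.
move=> uh h; apply: leq_trans (sum_size_vals l uh).
rewrite -sum1_size big_distrr /= [X in X <= _]big_seq [X in _ <= X]big_seq.
by apply: leq_sum => x /h; rewrite muln1.
Qed.

(** [hs] lists the keys in the order in which they reach the threshold [t]. Identifiers are
    positions plus one, so that 0 stands for a light key. *)
Definition indexed (f : nat -> nat) (t : nat) (l : seq (nat * nat))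
    (m : nat -> int -> int) : Prop :=
  [/\ forall x, m (f 2) (Posz x) = Posz (size (vals l x)),
      forall x r, m (f 3) (Posz (pr x r)) = Posz (nth 0 (vals l x) r),
      forall x v, m (f 4) (Posz (pr x v)) = Posz (v \in vals l x) &
      exists hs : seq nat, [/\ uniq hs, forall x, (x \in hs) = (t <= size (vals l x)),
        m (f 6) 0%R = Posz (size hs) &
        forall x, m (f 5) (Posz x) = Posz (if x \in hs then (index x hs).+1 else 0)]].

(* Arrays of one index: 0 keys, 1 values, 2 degrees, 3 adjacency lists,
   4 membership bits, 5 identifiers of the keys of degree at least the
   threshold, 6 number of identifiers. *)
Definition index_cmd (f : nat -> nat) (sz th : nat) : cmd :=
  let key := Get (f 0) (Reg 7) in
  let val := Bin Add (Get (f 1) (Reg 7)) (Cst 1) in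
  For 7 sz
    (Seq (Store (f 4) (pairE key val) (Cst 1))
    (Seq (Store (f 3) (pairE key (Get (f 2) key)) val)
    (Seq (Store (f 2) key (Bin Add (Get (f 2) key) (Cst 1)))
         (If (Bin Equal (Get (f 2) key) (Reg th))
             (Seq (Store (f 6) (Cst 0) (Bin Add (Get (f 6) (Cst 0)) (Cst 1)))
                  (Store (f 5) key (Get (f 6) (Cst 0))))
             Skip)))).

Definition upd (m : nat -> int -> int) (a : nat) (i v : int) : nat -> int -> int :=
  fun b j => if (b == a) && (j == i) then v else m b j.

(** A degree grows by one at a time and so equals [t] at exactly one insertion; the key is absent
    from [hs] until then and receives the next identifier at that moment. *)
Lemma indexed_rcons (f : nat -> nat) (t : nat) (l : seq (nat * nat))
    (m : nat -> int -> int) (x y : nat) :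
  injective f -> 0 < t -> indexed f t l m ->
  let d := size (vals l x) in
  let m3 := upd (upd (upd m (f 4) (Posz (pr x y.+1)) 1%R)
                     (f 3) (Posz (pr x d)) (Posz y.+1))
                (f 2) (Posz x) (Posz d.+1) in
  (d.+1 != t -> indexed f t (rcons l (x, y)) m3) /\
  (d.+1 = t -> forall c, m (f 6) 0%R = Posz c ->
   indexed f t (rcons l (x, y))
     (upd (upd m3 (f 6) 0%R (Posz c.+1)) (f 5) (Posz x) (Posz c.+1))).
Proof.
move=> fi t0 [I1 I2 I3 [hs [uh hsP hc hid]]] d m3.
have A1 z : m3 (f 2) (Posz z) = Posz (size (vals (rcons l (x, y)) z)).
  rewrite /m3 /upd !(inj_eq fi) /= vals_rcons /= eqz_nat.
  by case: eqP => [->|_]; rewrite ?size_rcons // I1.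
have A2 z r : m3 (f 3) (Posz (pr z r)) = Posz (nth 0 (vals (rcons l (x, y)) z) r).
  rewrite /m3 /upd !(inj_eq fi) /= vals_rcons /= pr_eq.
  case: (eqVneq z x) => [->|_] /=; last by rewrite I2.
  rewrite nth_rcons -/d; case: (ltngtP r d) => [h|h|h] //=; rewrite I2 //.
  by rewrite nth_default // ltnW.
have A3 z v : m3 (f 4) (Posz (pr z v)) = Posz (v \in vals (rcons l (x, y)) z).
  rewrite /m3 /upd !(inj_eq fi) /= vals_rcons /= pr_eq.
  case: (eqVneq z x) => [->|_] /=; last by rewrite I3.
  by rewrite mem_rcons inE; case: eqP => //= _; rewrite I3.
have A5 j : m3 (f 5) j = m (f 5) j by rewrite /m3 /upd !(inj_eq fi).
have A6 j : m3 (f 6) j = m (f 6) j by rewrite /m3 /upd !(inj_eq fi).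
split=> [dt|dt c mc].
  split=> //; exists hs; split; rewrite ?A6 // => z; last by rewrite A5.
    rewrite hsP vals_rcons /=; case: eqP => // ->; rewrite size_rcons -/d.
    by rewrite [RHS]leq_eqVlt eq_sym (negbTE dt).
have xhs : x \notin hs by rewrite hsP -/d -dt ltnn.
have ec : c = size hs by apply/eqP; rewrite -eqz_nat -mc hc.
split=> [z|z r|z v|].
- by rewrite -A1 /upd !(inj_eq fi).
- by rewrite -A2 /upd !(inj_eq fi).
- by rewrite -A3 /upd !(inj_eq fi).
exists (rcons hs x); split.
- by rewrite rcons_uniq xhs.
- move=> z; rewrite mem_rcons inE hsP vals_rcons /=.
  by case: eqP => [->|//]; rewrite size_rcons -/d dt leqnn.
- by rewrite [LHS]/upd (inj_eq fi) /= /upd eqxx /= size_rcons ec.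
move=> z; rewrite /upd !(inj_eq fi) /= A5 eqz_nat mem_rcons inE -cats1 index_cat.
case: (eqVneq z x) => [->|zx] /=.
  by rewrite (negbTE xhs) eqxx addn0 ec.
by rewrite hid; case: ifP.
Qed.

(** * Running time of the construction of an index *)

Section Index.

Variables M u : nat.
Hypotheses (u_gt1 : 1 < u) (uM : u ^ 8 <= M).

Lemma run_store_eq (a : nat) (e1 e2 : expr) (i v : int) (s : state)
    (Q : state -> Prop) :
  wf u s -> low 8 e1 -> low 8 e2 -> eval s e1 = i -> eval s e2 = v ->
  `|v| <= u -> Q (set_mem s a i v) ->
  run M u (Store a e1 e2) (cost e1 + cost e2).+1 s Q.
Proof. by move=> w l1 l2 <- <- vu q; apply: run_store. Qed.

Lemma run_store_seq (a : nat) (e1 e2 : expr) (i v : int) (c : cmd) (t : nat)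
    (s : state) (Q : state -> Prop) :
  wf u s -> low 8 e1 -> low 8 e2 -> eval s e1 = i -> eval s e2 = v ->
  `|v| <= u ->
  (wf u (set_mem s a i v) -> run M u c t (set_mem s a i v) Q) ->
  run M u (Seq (Store a e1 e2) c) ((cost e1 + cost e2).+1 + t) s Q.
Proof.
move=> w l1 l2 h1 h2 vu q.
apply: (run_seq (P := fun s' => s' = set_mem s a i v)).
  by apply: run_store_eq h1 h2 vu _.
by move=> s' w' _ e; rewrite e; apply: q; rewrite -e.
Qed.

Lemma run_index (f : nat -> nat) (sz th t : nat) (l : seq (nat * nat)) (s : state) :
  wf u s -> injective f -> sz != 7 -> th != 7 -> 0 < t ->
  reg s sz = Posz (size l) -> reg s th = Posz t ->
  (forall i, i < size l -> mem s (f 0) (Posz i) = Posz (nth (0, 0) l i).1) ->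
  (forall i, i < size l -> mem s (f 1) (Posz i) = Posz (nth (0, 0) l i).2) ->
  (forall i, i < size l -> (nth (0, 0) l i).2 < u) ->
  (forall i j, 1 < i -> mem s (f i) j = 0%R) ->
  run M u (index_cmd f sz th) (size l * 100 + 6) s (fun s' => indexed f t l (mem s')).
Proof.
move=> w fi sz7 th7 t0 rsz rth kE vE vu z0.
have su : size l <= u by have := w.1 sz; rewrite rsz.
apply: (run_weaken (t := size l * (92 + 8) + 6)
  (P := fun s' => indexed f t (take (size l) l) (mem s'))); [|lia|by rewrite take_size].
apply: (run_for u_gt1 uM (I := fun i m => indexed f t (take i l) m)) => //.
- by rewrite eq_sym.
- rewrite take0; split=> [x|x r|x v|]; rewrite ?z0 //= ?nth_nil //.
  exists [::]; split=> //= [x|x]; last by rewrite z0.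
  by rewrite in_nil /vals /=; case: t t0 {rth}.
move=> i s' il w' fr r7 Ii.
have [x [y xy]] : exists x y, nth (0, 0) l i = (x, y).
  by case: (nth _ _ _) => x y; exists x, y.
rewrite (take_nth (0, 0)) // xy.
have [B1 B2] := indexed_rcons x y fi t0 Ii.
have [I1 I2 I3 [hs [uh hsP hc hid]]] := Ii.
pose d := size (vals (take i l) x).
have di : d <= i.
  apply: leq_trans (_ : size (take i l) <= i); last by rewrite size_take; case: ltnP; lia.
  by rewrite /d /vals size_map size_filter count_size.
(* The number of identifiers is itself stored, so it must stay below [u]; it is at most [i] because
   the threshold is positive. *)
have hi : size hs <= i.
  apply: leq_trans (_ : size (take i l) <= i); last by rewrite size_take; case: ltnP; lia.
  have := @heavy_count (take i l) hs t uh; set n := size (take i l) => h.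
  by apply: leq_trans (leq_pmull _ t0) (h _) => z; rewrite hsP.
have mk : mem s' (f 0) (Posz i) = Posz x.
  by rewrite fr.2 /= ?(inj_eq fi) //= kE // xy.
have mv : mem s' (f 1) (Posz i) = Posz y.
  by rewrite fr.2 /= ?(inj_eq fi) //= vE // xy.
have yu : y < u by have := vu i il; rewrite xy.
have rt : reg s' th = Posz t by rewrite fr.1 //= (negbTE th7).
apply: (run_weaken (t := 20 + (24 + (9 + (8 + 12))))); [|by []|by move=> ? _ _; exact].
apply: (run_store_seq (i := Posz (pr x y.+1)) (v := 1%R)) => //=.
  by rewrite r7 mk mv -[y.+1]addn1 /pr !PoszD PoszM !PoszD.
  exact: ltnW.
move=> w1.
apply: (run_store_seq (i := Posz (pr x d)) (v := Posz y.+1)) => //=.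
- by rewrite r7 !(inj_eq fi) /= mk I1.
- by rewrite r7 !(inj_eq fi) /= mv -[y.+1]addn1 PoszD.
move=> w2.
apply: (run_store_seq (i := Posz x) (v := Posz d.+1)) => //=.
- by rewrite r7 !(inj_eq fi) /= mk.
- by rewrite r7 !(inj_eq fi) /= mk I1 -[d.+1]addn1 PoszD.
- by lia.
move=> w3.
apply: (run_if u_gt1 uM) => //=; rewrite r7 !(inj_eq fi) /= mk eqxx rt eqz_nat.
  case: (eqVneq d.+1 t) => // dt _.
  have {}B2 := B2 dt _ hc.
  apply: (run_weaken (t := 6 + 5)); [|by []|by move=> ? _ _; exact].
  apply: (run_store_seq (i := 0%R) (v := Posz (size hs).+1)) => //=.
  - by rewrite !(inj_eq fi) /= hc -[(size hs).+1]addn1 PoszD.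
  - exact: leq_ltn_trans hi (leq_trans il su).
  move=> w4.
  apply: (run_store_eq (i := Posz x) (v := Posz (size hs).+1)) => //=.
  - by rewrite r7 !(inj_eq fi) /= mk.
  - by rewrite !(inj_eq fi).
  - exact: leq_ltn_trans hi (leq_trans il su).
case: (eqVneq d.+1 t) => // dt _.
apply: (run_weaken (t := 1)); [|by []|by move=> ? _ _; exact].
by apply: run_skip => //; exact: B1.
Qed.
End Index.

(** * Interleaved copies of a program *)

(* Copy number [j = reg 8] of a program, out of [L = reg 6] copies.  Its
   registers become arrays, read at index j; cell i of its array a becomes cell
   i * L + j, so that the copies share arrays but no cells. *)
Definition cellE (e : expr) : expr := Bin Add (Bin Mul e (Reg 6)) (Reg 8).

Fixpoint trE (e : expr) : expr :=
  match e with
  | Cst c => Cst c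
  | Reg x => Get (24 + x.*2) (Reg 8)
  | Get a e1 => Get (25 + a.*2) (cellE (trE e1))
  | Bin o e1 e2 => Bin o (trE e1) (trE e2)
  end.

Fixpoint trC (c : cmd) : cmd :=
  match c with
  | Skip => Skip
  | Assign x e => Store (24 + x.*2) (Reg 8) (trE e)
  | Store a e1 e2 => Store (25 + a.*2) (cellE (trE e1)) (trE e2)
  | Seq c1 c2 => Seq (trC c1) (trC c2)
  | If e c1 c2 => If (trE e) (trC c1) (trC c2)
  | While e c1 => While (trE e) (trC c1)
  end.

(** The abstraction map of the simulation: the state of the original program that copy [j]
    represents. Simulated registers and arrays are kept apart by the parity of the array number. *)
Definition view (L j : nat) (m : nat -> int -> int) : state :=
  State (fun x => m (24 + x.*2) (Posz j))
        (fun a i => m (25 + a.*2) (i * Posz L + Posz j)%R).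

(** The worst case is an array access, whose address computation turns one step into five. *)
Lemma cost_trE (e : expr) : cost (trE e) <= 5 * cost e.
Proof. by elim: e => //= [a e|o e1 IH1 e2]; lia. Qed.

Lemma wr_trC (c : cmd) (x : nat) : wr (trC c) x = false.
Proof. by elim: c => //= [c1 -> c2 ->|e c1 -> c2 ->]. Qed.

Lemma wa_trC (c : cmd) (a : nat) : a < 24 -> wa (trC c) a = false.
Proof.
move=> h; elim: c => //= [x e|b e1 e2|c1 -> c2 ->|e c1 -> c2 ->] //.
  by apply/eqP; lia.
by apply/eqP; lia.
Qed.

(** Uniqueness of Euclidean division by [L], also for negative array indices. *)
Lemma cell_inj (L j j' : nat) (i i' : int) : j < L -> j' < L ->
  (i * Posz L + Posz j = i' * Posz L + Posz j')%R -> i = i' /\ j = j'.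
Proof.
move=> jL j'L e; have ii : i = i'.
  by case: (ltgtP i i') => // h; nia.
by split=> //; move: e; rewrite ii; lia.
Qed.

Lemma view_reg (L j x : nat) (m : nat -> int -> int) (v : int) :
  view L j (upd m (24 + x.*2) (Posz j) v) = set_reg (view L j m) x v.
Proof.
rewrite /view /set_reg /upd; congr State.
  apply/funext => y /=; rewrite eqxx andbT.
  by rewrite (_ : (24 + y.*2 == 24 + x.*2) = (y == x)) //; apply/eqP/eqP; lia.
apply/funext => a; apply/funext => i /=.
by rewrite (_ : (25 + a.*2 == 24 + x.*2) = false) //; apply/eqP; lia.
Qed.

Lemma view_reg_other (L j j' x : nat) (m : nat -> int -> int) (v : int) :
  j' != j -> view L j' (upd m (24 + x.*2) (Posz j) v) = view L j' m.
Proof.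
move=> jj; rewrite /view /upd; congr State.
  by apply/funext => y /=; rewrite eqz_nat (negbTE jj) andbF.
apply/funext => a; apply/funext => i /=.
by rewrite (_ : (25 + a.*2 == 24 + x.*2) = false) //; apply/eqP; lia.
Qed.

Lemma view_mem (L j a : nat) (m : nat -> int -> int) (i v : int) : j < L ->
  view L j (upd m (25 + a.*2) (i * Posz L + Posz j)%R v) = set_mem (view L j m) a i v.
Proof.
move=> jL; rewrite /view /set_mem /upd; congr State.
  apply/funext => y /=.
  by rewrite (_ : (24 + y.*2 == 25 + a.*2) = false) //; apply/eqP; lia.
apply/funext => b; apply/funext => i' /=.
rewrite (_ : (25 + b.*2 == 25 + a.*2) = (b == a)); last by apply/eqP/eqP; lia.
congr (if _ && _ then _ else _).
by apply/eqP/eqP => [/(cell_inj jL jL)[]|->].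
Qed.

Lemma view_mem_other (L j j' a : nat) (m : nat -> int -> int) (i v : int) :
  j < L -> j' < L -> j' != j ->
  view L j' (upd m (25 + a.*2) (i * Posz L + Posz j)%R v) = view L j' m.
Proof.
move=> jL j'L jj; rewrite /view /upd; congr State.
  apply/funext => y /=.
  by rewrite (_ : (24 + y.*2 == 25 + a.*2) = false) //; apply/eqP; lia.
apply/funext => b; apply/funext => i' /=.
case: eqP => //= _; case: eqP => // /(cell_inj j'L jL)[_ e].
by rewrite e eqxx in jj.
Qed.

Lemma eval_trE (L j : nat) (s : state) (e : expr) :
  reg s 6 = Posz L -> reg s 8 = Posz j ->
  eval s (trE e) = eval (view L j (mem s)) e.
Proof.
move=> s6 s8; elim: e => //= [x|a e ->|o e1 -> e2 ->] //.
  by rewrite s8.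
by rewrite s6 s8.
Qed.

Lemma fits_eval (M : nat) (s : state) (e : expr) : fits M s e -> `|eval s e| <= M.
Proof. by case: e => [c|x|a e|o e1 e2] /= /andP[]. Qed.

Section Simulation.

Variables M u M0 : nat.
Hypotheses (u_gt1 : 1 < u) (uM : u ^ 8 <= M) (M0u : M0 <= u).

(** Makes an address [v * L + j] a word when [v], [L] and [j] are at most [u]. *)
Let uM2 : u * u + u <= M.
Proof.
apply: leq_trans uM; rewrite (_ : 8 = 3 + 5) // expnD.
apply: (@leq_trans (u ^ 3)); last by rewrite leq_pmulr // expn_gt0 ltnW.
by rewrite !expnS expn0; nia.
Qed.

Let u_le : u <= M.
Proof. by apply: leq_trans uM2; rewrite leq_addl. Qed.

Let M0M : M0 <= M.
Proof. exact: leq_trans u_le. Qed.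

Lemma fits_cellE (L j : nat) (s : state) (e : expr) :
  wf u s -> reg s 6 = Posz L -> reg s 8 = Posz j -> fits M s e ->
  `|eval s e| <= u -> fits M s (cellE e).
Proof.
move=> w s6 s8 fe.
have Lu := w.1 6; rewrite s6 /= in Lu; have ju := w.1 8; rewrite s8 /= in ju.
rewrite /= fe s6 s8; set v := eval _ e => hv.
have hvL : `|(v * Posz L)%R| <= u * u by rewrite abszM leq_mul.
have hvLj : `|(v * Posz L + Posz j)%R| <= u * u + u by lia.
rewrite (leq_trans hvLj uM2) (leq_trans hvL (leq_trans (leq_addr u _) uM2)) /=.
by rewrite (leq_trans Lu u_le) (leq_trans ju u_le).
Qed.

Lemma fits_trE (L j : nat) (s : state) (e : expr) :
  wf u s -> reg s 6 = Posz L -> reg s 8 = Posz j ->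
  fits M0 (view L j (mem s)) e -> fits M s (trE e).
Proof.
move=> w s6 s8; elim: e => [c|x|a e IH|o e1 IH1 e2 IH2].
- by rewrite /= !andbT => h; exact: leq_trans M0M.
- rewrite /= !andbT s8 /= => h; rewrite (leq_trans h M0M).
  by have := w.1 8; rewrite s8 => /leq_trans-> //; exact: u_le.
- move=> fe; have := fits_eval fe; rewrite -(eval_trE _ s6 s8) => h.
  rewrite [trE _]/= /fits -/fits -[Get _ _]/(trE (Get a e)) (leq_trans h M0M).
  have {}fe : fits M0 (view L j (mem s)) e by case/andP: fe.
  apply: (fits_cellE w s6 s8 (IH fe)); rewrite (eval_trE _ s6 s8).
  exact: leq_trans (fits_eval fe) M0u.
rewrite /= => /and3P[h f1 f2]; rewrite IH1 // IH2 // !(eval_trE _ s6 s8) !andbT.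
exact: leq_trans h M0M.
Qed.

(** Induction on the original execution. The other copies must be shown unchanged so that each of
    them is still fresh when its turn comes; [M0 <= u] makes every value stored by the simulated
    program admissible for [wf]. *)
Lemma exec_trC (L j : nat) (c : cmd) (s0 s0' : state) (n : nat) :
  exec M0 c s0 n s0' -> forall s, wf u s -> j < L ->
  reg s 6 = Posz L -> reg s 8 = Posz j -> s0 = view L j (mem s) ->
  run M u (trC c) (5 * n) s (fun s' => s0' = view L j (mem s') /\
    forall j', j' < L -> j' != j -> view L j' (mem s') = view L j' (mem s)).
Proof.
elim=> {c s0 s0' n}.
- by move=> st s w jL s6 s8 ->; exists 1, s; split=> //; constructor.
- move=> st x e fe s w jL s6 s8 e0; rewrite e0 in fe *.
  have ce := cost_trE e.
  have hx : exec M (trC (Assign x e)) s (1 + cost (trE e)).+1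
      (set_mem s (24 + x.*2) (eval s (Reg 8)) (eval s (trE e))).
    apply: ExecStore; last exact: fits_trE fe.
    by rewrite /= andbT; exact: leq_trans (w.1 8) u_le.
  rewrite [eval s (Reg 8)]s8 (eval_trE e s6 s8) in hx.
  eexists; eexists; split; first exact: hx.
  + by rewrite /=; lia.
  + by apply: wf_set_mem => //; exact: leq_trans (fits_eval fe) M0u.
  + split=> [|j' j'L jj]; [exact/esym/view_reg|exact: view_reg_other].
- move=> st a e1 e2 f1 f2 s w jL s6 s8 e0; rewrite e0 in f1 f2 *.
  have ce1 := cost_trE e1; have ce2 := cost_trE e2.
  have hx : exec M (trC (Store a e1 e2)) s (cost (cellE (trE e1)) + cost (trE e2)).+1
      (set_mem s (25 + a.*2) (eval s (cellE (trE e1))) (eval s (trE e2))).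
    apply: ExecStore; last exact: fits_trE f2.
    apply: (fits_cellE w s6 s8); first exact: fits_trE f1.
    by rewrite (eval_trE _ s6 s8) (leq_trans (fits_eval f1)).
  rewrite [eval s (cellE _)]/= s6 s8 !(eval_trE _ s6 s8) in hx.
  eexists; eexists; split; first exact: hx.
  + by rewrite /=; lia.
  + by apply: wf_set_mem => //; exact: leq_trans (fits_eval f2) M0u.
  + split=> [|j' j'L jj]; [exact/esym/view_mem|exact: view_mem_other].
- move=> s1 s2 s3 c1 c2 n1 n2 _ IH1 _ IH2 s w jL s6 s8 e0.
  rewrite mulnDr; apply: run_seq (IH1 s w jL s6 s8 e0) _ => s' w' fr [e' o'].
  have r6 : reg s' 6 = Posz L by rewrite fr.1 // wr_trC.
  have r8 : reg s' 8 = Posz j by rewrite fr.1 // wr_trC.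
  apply: run_weaken (IH2 s' w' jL r6 r8 e') (leqnn _) _ => s'' w'' _ [e'' o''].
  by split=> // j' j'L jj; rewrite o'' // o'.
- move=> st st' e c1 c2 n fe ne _ IH s w jL s6 s8 e0; rewrite e0 in fe ne.
  have [n' [s' [hx le w' q]]] := IH s w jL s6 s8 e0; have ce := cost_trE e.
  exists ((cost (trE e)).+1 + n'), s'; split=> //; last lia.
  by apply: ExecIfTrue => //; rewrite ?(eval_trE _ s6 s8) //; exact: fits_trE fe.
- move=> st st' e c1 c2 n fe ne _ IH s w jL s6 s8 e0; rewrite e0 in fe ne.
  have [n' [s' [hx le w' q]]] := IH s w jL s6 s8 e0; have ce := cost_trE e.
  exists ((cost (trE e)).+1 + n'), s'; split=> //; last lia.
  by apply: ExecIfFalse => //; rewrite ?(eval_trE _ s6 s8) //; exact: fits_trE fe.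
- move=> st1 st2 st3 e c n1 n2 fe ne _ IH1 _ IH2 s w jL s6 s8 e0.
  rewrite e0 in fe ne; have ce := cost_trE e.
  have [n' [s' [hx le w' [fr [e' o']]]]] := run_frame (IH1 s w jL s6 s8 e0).
  have r6 : reg s' 6 = Posz L by rewrite fr.1 // wr_trC.
  have r8 : reg s' 8 = Posz j by rewrite fr.1 // wr_trC.
  have [n'' [s'' [hx' le' w'' [e'' o'']]]] := IH2 s' w' jL r6 r8 e'.
  exists ((cost (trE e)).+1 + n' + n''), s''; split=> //.
  + apply: ExecWhileTrue hx hx'; rewrite ?(eval_trE _ s6 s8) //; exact: fits_trE fe.
  + by lia.
  + by split=> // j' j'L jj; rewrite o'' // o'.
move=> st e c fe ne s w jL s6 s8 e0; rewrite e0 in fe ne *; have ce := cost_trE e.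
exists (cost (trE e)).+1, s; split=> //; last lia.
by apply: ExecWhileFalse; rewrite ?(eval_trE _ s6 s8) //; exact: fits_trE fe.
Qed.

End Simulation.

(** * The phases of the batch program *)

(** Describes an array whose cells are only ever set to 1 by the list of the indices written so
    far. *)
Definition bits (g : int -> int) (l : seq int) : Prop :=
  forall c, g c = Posz (c \in l).

Lemma bits_rcons (m : nat -> int -> int) (a : nat) (l : seq int) (c : int) :
  bits (m a) l -> bits (upd m a c 1%R a) (rcons l c).
Proof.
by move=> h c'; rewrite /upd eqxx mem_rcons inE /=; case: eqP => //= _; exact: h.
Qed.

Lemma iota_rcons (n : nat) : iota 0 n.+1 = rcons (iota 0 n) n.
Proof. by rewrite -addn1 iotaD /= cats1. Qed.

Lemma nth_pair (l : seq (nat * nat)) (i : nat) :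
  exists x y, nth (0, 0) l i = (x, y).
Proof. by case: (nth _ _ _) => x y; exists x, y. Qed.

Definition holds_pairs (m : nat -> int -> int) (a b : nat) (l : seq (nat * nat)) : Prop :=
  forall i, i < size l ->
    m a (Posz i) = Posz (nth (0, 0) l i).1 /\ m b (Posz i) = Posz (nth (0, 0) l i).2.

(* Registers: 0-2 sizes of R, S, T; 3 d; 4 n; 5 degree threshold of heavy sets;
   6 L; 7-9 loop counters.  Arrays: 0-5 inputs; 6 answers; 7 d during its
   computation; 8 marked pairs (x, z + 1); 9-13, 14-18 and 19-23 indexes of R by
   x, of S by z and of S by y; from 24 on, the copies of the multiplication
   program, whose inputs are 25 and 27 and whose output is 29. *)
Definition mark_cmd : cmd :=
  For 7 0 (For 9 3
    (Store 8 (pairE (Get 0 (Reg 7)) (Get 20 (pairE (Get 1 (Reg 7)) (Reg 9)))) (Cst 1))).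

(** If the identifier of y is [t * L + j], the index equals [(hx * n + t) * L + j], which is the
    cell of entry [(hx, t)] in copy [j]. A heavy y thus goes to block [j], its identifier modulo
    [L], at position [t], the quotient. *)
Definition fillA_cmd : cmd :=
  For 7 0
    (Store 25 (Bin Add (Bin Mul (Get 12 (Get 0 (Reg 7))) (Bin Mul (Reg 4) (Reg 6)))
                       (Get 22 (Get 1 (Reg 7)))) (Cst 1)).

(** Skipping light y on this side is enough. On the other side they fall on column 0 of block 0,
    which meets a row 0 of block 0 that stays empty here. Light x and z use row 0 and column 0,
    which no request reads. *)
Definition fillB_cmd : cmd :=
  let hy := Get 22 (Get 3 (Reg 7)) in
  let q := Bin Div hy (Reg 6) in
  For 7 1
    (If hy
      (Store 27 (Bin Add (Bin Mul (Bin Add (Bin Mul q (Reg 4)) (Get 17 (Get 2 (Reg 7))))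
                                  (Reg 6))
                         (Bin Sub hy (Bin Mul q (Reg 6)))) (Cst 1))
      Skip).

(** * Running time and effect of the loops that scatter pairs into bit arrays *)

Section Scatter.

Variables M u : nat.
Hypotheses (u_gt1 : 1 < u) (uM : u ^ 8 <= M).

Lemma run_store_le (a : nat) (e1 e2 : expr) (i v : int) (t : nat) (s : state)
    (Q : state -> Prop) :
  wf u s -> low 8 e1 -> low 8 e2 -> (cost e1 + cost e2).+1 <= t ->
  eval s e1 = i -> eval s e2 = v -> `|v| <= u -> Q (set_mem s a i v) ->
  run M u (Store a e1 e2) t s Q.
Proof.
move=> w l1 l2 ht h1 h2 vu q.
by apply: (run_weaken (run_store_eq u_gt1 uM w l1 l2 h1 h2 vu q)).
Qed.

Lemma run_mark (l : seq (nat * nat)) (d : nat) (g : nat -> nat -> nat) (s : state) :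
  wf u s -> reg s 0 = Posz (size l) -> reg s 3 = Posz d -> holds_pairs (mem s) 0 1 l ->
  (forall y r, mem s 20 (Posz (pr y r)) = Posz (g y r)) -> bits (mem s 8) [::] ->
  run M u mark_cmd (size l * (d * 60 + 20) + 6) s (fun s' => bits (mem s' 8)
    (flatten [seq [seq Posz (pr q.1 (g q.2 r)) | r <- iota 0 d] | q <- l])).
Proof.
move=> w s0 s3 hl hg b0; set row := fun q => [seq _ | r <- _].
apply: (run_weaken (t := size l * (d * (50 + 8) + 6 + 8) + 6)
  (P := fun s' => bits (mem s' 8) (flatten [seq row q | q <- take (size l) l]))).
- apply: (run_for u_gt1 uM (I := fun i m =>
    bits (m 8) (flatten [seq row q | q <- take i l]))) => //.
    by rewrite take0.
  move=> i s1 il w1 f1 r7 I1.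
  have [x [y xy]] := nth_pair l i; have [hx hy] := hl i il; rewrite xy /= in hx hy.
  rewrite (take_nth (0, 0)) // map_rcons flatten_rcons xy /row.
  apply: (run_for u_gt1 uM (I := fun r m => bits (m 8)
    (flatten [seq row q | q <- take i l] ++ [seq Posz (pr x (g y r)) | r <- iota 0 r]))) => //.
  + by rewrite f1.1.
  + by rewrite cats0.
  move=> r s2 rd w2 f2 r9 I2.
  have E : eval s2 (pairE (Get 0 (Reg 7)) (Get 20 (pairE (Get 1 (Reg 7)) (Reg 9))))
         = Posz (pr x (g y r)).
    rewrite /= r9 f2.1 // r7 f2.2 // f1.2 // f2.2 // f1.2 // f2.2 // f1.2 // hx hy.
    by have := hg y r; rewrite /pr => ->.
  apply: (run_store_le (v := 1%R) w2 _ _ _ E) => //; first exact: ltnW.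
  rewrite iota_rcons map_rcons -rcons_cat; exact: bits_rcons.
- by lia.
by rewrite take_size.
Qed.

Lemma run_fillA (l : seq (nat * nat)) (n L : nat) (hx hy : nat -> nat) (s : state) :
  wf u s -> reg s 0 = Posz (size l) -> reg s 4 = Posz n -> reg s 6 = Posz L ->
  holds_pairs (mem s) 0 1 l ->
  (forall x, mem s 12 (Posz x) = Posz (hx x)) ->
  (forall y, mem s 22 (Posz y) = Posz (hy y)) -> bits (mem s 25) [::] ->
  run M u fillA_cmd (size l * 30 + 6) s (fun s' => bits (mem s' 25)
    [seq Posz (hx q.1 * (n * L) + hy q.2) | q <- l]).
Proof.
move=> w s0 s4 s6 hl h12 h22 b0; set e := fun q => Posz _.
apply: (run_weaken (t := size l * (22 + 8) + 6)
  (P := fun s' => bits (mem s' 25) [seq e q | q <- take (size l) l])).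
- apply: (run_for u_gt1 uM (I := fun i m => bits (m 25) [seq e q | q <- take i l])) => //.
    by rewrite take0.
  move=> i s1 il w1 f1 r7 I1.
  have [x [y xy]] := nth_pair l i; have [kx ky] := hl i il; rewrite xy /= in kx ky.
  rewrite (take_nth (0, 0)) // map_rcons xy.
  have E : eval s1 (Bin Add (Bin Mul (Get 12 (Get 0 (Reg 7))) (Bin Mul (Reg 4) (Reg 6)))
                       (Get 22 (Get 1 (Reg 7)))) = e (x, y).
    by rewrite /= r7 !f1.2 // !f1.1 // kx ky h12 h22 s4 s6.
  apply: (run_store_le (v := 1%R) w1 _ _ _ E) => //; first exact: ltnW.
  exact: bits_rcons.
- by lia.
by rewrite take_size.
Qed.

Lemma run_fillB (l : seq (nat * nat)) (n L : nat) (hz hy : nat -> nat) (s : state) :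
  wf u s -> reg s 1 = Posz (size l) -> reg s 4 = Posz n -> reg s 6 = Posz L ->
  holds_pairs (mem s) 2 3 l ->
  (forall z, mem s 17 (Posz z) = Posz (hz z)) ->
  (forall y, mem s 22 (Posz y) = Posz (hy y)) -> bits (mem s 27) [::] ->
  run M u fillB_cmd (size l * 70 + 6) s (fun s' => bits (mem s' 27)
    [seq Posz ((hy q.2 %/ L * n + hz q.1) * L + hy q.2 %% L) | q <- l & hy q.2 != 0]).
Proof.
move=> w s1 s4 s6 hl h17 h22 b0; set e := fun q => Posz _; set p := fun q => _ != _.
apply: (run_weaken (t := size l * (62 + 8) + 6)
  (P := fun s' => bits (mem s' 27) [seq e q | q <- take (size l) l & p q])).
- apply: (run_for u_gt1 uM (I := fun i m => bits (m 27) [seq e q | q <- take i l & p q])) => //.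
    by rewrite take0.
  move=> i s2 il w2 f2 r7 I2.
  have [z [y zy]] := nth_pair l i; have [kz ky] := hl i il; rewrite zy /= in kz ky.
  rewrite (take_nth (0, 0)) // filter_rcons zy.
  have Ey : eval s2 (Get 22 (Get 3 (Reg 7))) = Posz (hy y).
    by rewrite /= r7 !f2.2 // ky h22.
  apply: (run_if u_gt1 uM (t := 58)) => //; rewrite Ey => hyE.
    have {}hyE : hy y != 0 by move: hyE; rewrite eqz_nat.
    rewrite /p /= hyE map_rcons.
    apply: (run_store_le (i := e (z, y)) (v := 1%R) w2) => //.
    - rewrite /= r7 !f2.2 // !f2.1 // kz ky h17 h22 s4 s6 divz_nat /e /=.
      rewrite [in RHS]PoszD [in RHS]PoszM [in RHS]PoszD [in RHS]PoszM.
      congr (_ + _)%R; rewrite {1}(divn_eq (hy y) L) PoszD PoszM; ring.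
    - exact: ltnW.
    exact: bits_rcons.
  case: hyE => hyE; rewrite /p /= hyE /=.
  by exists 1, s2; split=> //; constructor.
- by lia.
by rewrite take_size.
Qed.

End Scatter.

(** The cube root d is searched by C trial increments, which suffice because C <= C^3; their cost is
    linear in C. *)
Definition setup_cmd : cmd :=
  let d := Get 7 (Cst 0) in
  Seq (For 7 2 (If (Bin Less (Bin Mul (Bin Mul d d) d) (Reg 2))
                   (Store 7 (Cst 0) (Bin Add d (Cst 1))) Skip))
  (Seq (Assign 3 d)
  (Seq (Assign 4 (Bin Mul (Reg 3) (Reg 3)))
  (Seq (Assign 5 (Bin Add (Bin Div (Reg 0) (Reg 4)) (Cst 1)))
       (Assign 6 (Bin Add (Bin Div (Reg 0) (Bin Mul (Reg 4) (Reg 3))) (Cst 1)))))).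

(** Array 24 holds register 0 of all copies, so the store passes the dimension to copy [j]. *)
Definition calls_cmd (p : cmd) : cmd :=
  For 8 6 (Seq (Store 24 (Reg 8) (Reg 4)) (trC p)).

Definition scan_cmd (bnd : nat) (e : expr) : cmd :=
  For 9 bnd (If e (Store 6 (Reg 7) (Cst 1)) Skip).

(** The four tests enumerate the set x, enumerate the set z, read the marks, and read one entry of
    each matrix product. In the last one a product of three factors acts as a conjunction. *)
Definition query_cmd : cmd :=
  let x := Get 4 (Reg 7) in
  let z := Get 5 (Reg 7) in
  let hx := Get 12 x in
  let hz := Get 17 z in
  For 7 2
    (Seq (scan_cmd 5 (Get 16 (pairE z (Get 10 (pairE x (Reg 9))))))
    (Seq (scan_cmd 5 (Get 11 (pairE x (Get 15 (pairE z (Reg 9))))))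
    (Seq (If (Get 8 (pairE x (Bin Add z (Cst 1)))) (Store 6 (Reg 7) (Cst 1)) Skip)
         (scan_cmd 6 (Bin Mul (Bin Mul hx hz)
           (Get 29 (Bin Add (Bin Mul (Bin Add (Bin Mul hx (Reg 4)) hz) (Reg 6))
                            (Reg 9)))))))).

(** * Parameter search and scans *)

Section Setup.

Variables M u : nat.
Hypotheses (u_gt1 : 1 < u) (uM : u ^ 8 <= M).

Lemma run_assign_seq (x : nat) (e : expr) (v : int) (c : cmd) (t : nat)
    (s : state) (Q : state -> Prop) :
  wf u s -> low 8 e -> eval s e = v -> `|v| <= u ->
  (wf u (set_reg s x v) -> run M u c t (set_reg s x v) Q) ->
  run M u (Seq (Assign x e) c) ((cost e).+1 + t) s Q.
Proof.
move=> w l1 h1 vu q.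
apply: (run_seq (P := fun s' => s' = set_reg s x v)).
  by rewrite -h1; apply: run_assign; rewrite ?h1.
by move=> s' w' _ e'; rewrite e'; apply: q; rewrite -e'.
Qed.

Lemma run_setup (N C : nat) (s : state) :
  wf u s -> reg s 0 = Posz N -> reg s 2 = Posz C -> mem s 7 0%R = 0%R ->
  0 < C -> C * C <= u -> N < u ->
  run M u setup_cmd (C * 40 + 50) s (fun s' =>
    exists d, [/\ d.-1 ^ 3 < C, C <= d ^ 3, 0 < d & [/\ reg s' 3 = Posz d,
      reg s' 4 = Posz (d * d), reg s' 5 = Posz (N %/ (d * d)).+1 &
      reg s' 6 = Posz (N %/ (d * d * d)).+1]]).
Proof.
move=> w s0 s2 s7 C0 CC Nu.
have Cu : C <= u by nia.
apply: (run_weaken (t := (C * (32 + 8) + 6) + 40)); [|lia|move=> ? _ _; exact].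
apply: (run_seq (P := fun s' => exists d, [/\ mem s' 7 0%R = Posz d,
  d = 0 \/ d.-1 ^ 3 < C & C <= d \/ C <= d ^ 3])).
  (* The second clause records minimality of [d]. The third says that either all rounds so far have
     incremented [d] or the search is over. *)
  apply: (run_for u_gt1 uM (I := fun i m => exists d, [/\ m 7 0%R = Posz d,
    d = 0 \/ d.-1 ^ 3 < C & i <= d \/ C <= d ^ 3])) => //.
    by exists 0; split=> //; left.
  move=> i s1 iC w1 f1 r7 [d [d7 d1 d2]].
  have E : eval s1 (Bin Less (Bin Mul (Bin Mul (Get 7 (Cst 0)) (Get 7 (Cst 0)))
                     (Get 7 (Cst 0))) (Reg 2)) = Posz (d ^ 3 < C).
    by rewrite /= d7 f1.1 // s2 -!PoszM ltz_nat !expnS expn0 muln1 mulnA.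
  apply: (run_if u_gt1 uM (t := 21)) => //; rewrite E.
    case: (ltnP (d ^ 3) C) => // dC _.
    apply: (run_store_le u_gt1 uM (i := 0%R) (v := Posz d.+1) w1) => //=.
    - by rewrite d7 -[d.+1]addn1 PoszD.
    - by apply: leq_trans Cu; apply: leq_ltn_trans dC; rewrite !expnS expn0; nia.
    exists d.+1; split=> //; first by right.
    by left; case: d2 => [|h]; lia.
  case: (ltnP (d ^ 3) C) => // dC _.
  exists 1, s1; split=> //; first by constructor.
  by exists d; split=> //; right.
move=> s1 w1 f1 [d [d7 d1 d2]].
have d0 : 0 < d by case: (posnP d) => // e; move: d2; rewrite e; lia.
have dC : d.-1 ^ 3 < C by case: d1 => // e; rewrite e in d0.
have Cd : C <= d ^ 3 by case: d2 => // h; apply: leq_trans h _; rewrite !expnS expn0; nia.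
have dC' : d <= C.
  by case: d d0 dC {d7 d1 d2 Cd} => //= d _; apply: leq_ltn_trans; rewrite !expnS expn0; nia.
have r0 : reg s1 0 = Posz N by rewrite f1.1.
have div1 k : `|Posz (N %/ k).+1| <= u.
  by rewrite /=; apply: leq_ltn_trans (leq_div _ _) Nu.
apply: (run_weaken (t := 3 + (4 + (6 + 8)))); [|by []|move=> ? _ _; exact].
apply: (run_assign_seq (v := Posz d)) => //=; first exact: leq_trans Cu.
move=> w2; apply: (run_assign_seq (v := Posz (d * d))) => //=.
  by apply: leq_trans CC; rewrite leq_mul.
move=> w3; apply: (run_assign_seq (v := Posz (N %/ (d * d)).+1)) => //=.
- by rewrite r0 divz_nat -addn1 PoszD.
- exact: (div1 (d * d)).
move=> w4.
have E : eval (set_reg (set_reg (set_reg s1 3 (Posz d)) 4 (Posz (d * d))) 5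
    (Posz (N %/ (d * d)).+1)) (Bin Add (Bin Div (Reg 0) (Bin Mul (Reg 4) (Reg 3))) (Cst 1))
    = Posz (N %/ (d * d * d)).+1.
  by rewrite /= r0 -PoszM divz_nat -addn1 PoszD.
apply: (run_assign u_gt1 uM) => //; rewrite ?E //.
by exists d.
Qed.

Lemma run_scan (bnd n i : nat) (e : expr) (P : nat -> bool) (b : bool) (s : state) :
  wf u s -> bnd != 9 -> reg s bnd = Posz n -> reg s 7 = Posz i ->
  mem s 6 (Posz i) = Posz b -> low 8 e -> cost e <= 90 ->
  (forall r s', r < n -> reg s' 9 = Posz r -> (forall x, x != 9 -> reg s' x = reg s x) ->
     (forall a, a != 6 -> mem s' a = mem s a) -> (eval s' e != 0%R) = P r) ->
  run M u (scan_cmd bnd e) (n * 110 + 6) s (fun s' =>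
    mem s' 6 (Posz i) = Posz (b || has P (iota 0 n)) /\
    forall c, c != Posz i -> mem s' 6 c = mem s 6 c).
Proof.
move=> w b9 sb s7 s6 le ce He.
apply: (run_weaken (t := n * (102 + 8) + 6)); [|by []|by move=> ? _ _; exact].
apply: (run_for u_gt1 uM (I := fun r m => m 6 (Posz i) = Posz (b || has P (iota 0 r)) /\
    forall c, c != Posz i -> m 6 c = mem s 6 c)) => //.
- by rewrite eq_sym.
- by rewrite orbF.
move=> r s1 rn w1 f1 r9 [I1 I2].
have E : (eval s1 e != 0%R) = P r.
  by apply: He => // [x x9|a a6]; [rewrite f1.1 //= (negbTE x9)|rewrite f1.2 //= (negbTE a6)].
rewrite iota_rcons has_rcons.
apply: (run_weaken (t := (cost e).+1 + 4)); [|lia|by move=> ? _ _; exact].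
apply: (run_if u_gt1 uM) => //= eE.
  have Pr : P r by rewrite -E.
  apply: (run_store_le u_gt1 uM (i := Posz i) (v := 1%R) w1) => //=.
  - by rewrite f1.1.
  - exact: ltnW.
  by rewrite eqxx Pr orbT; split=> // c ci; rewrite (negbTE ci) I2.
have -> : P r = false by rewrite -E eE eqxx.
by exists 1, s1; split=> //; constructor.
Qed.

End Setup.

(** * Multiplication calls and the loop over the requests *)

Section Queries.

Variables M u : nat.
Hypotheses (u_gt1 : 1 < u) (uM : u ^ 8 <= M).

(** Before its turn a copy holds its two matrices and null registers; storing [n] in register 0
    turns it into the initial state of [p]. Each call may have its own word bound [M0]. *)
Lemma run_calls (p : cmd) (n L T : nat) (A B : nat -> 'M[int]_n) (s : state) :
  let inp j := init [:: Posz n] [:: row_major (A j); row_major (B j)] in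
  wf u s -> reg s 4 = Posz n -> reg s 6 = Posz L ->
  (forall j, j < L -> view L j (mem s) = State (fun=> 0%R) (mem (inp j))) ->
  (forall j, j < L -> exists M0 t st, [/\ M0 <= u, exec M0 p (inp j) t st, t <= T &
     forall a b : 'I_n, mem st 2 (Posz (a * n + b)) = (A j *m B j)%R a b]) ->
  run M u (calls_cmd p) (L * (5 * T + 11) + 6) s (fun s' =>
    forall j (a b : 'I_n), j < L ->
      mem s' 29 (Posz ((a * n + b) * L + j)) = (A j *m B j)%R a b).
Proof.
move=> inp w s4 s6 hv hp.
apply: (run_weaken (t := L * ((3 + 5 * T) + 8) + 6) (P := fun s' =>
  (forall j (a b : 'I_n), j < L ->
     (view L j (mem s')).(mem) 2 (Posz (a * n + b)) = (A j *m B j)%R a b) /\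
  forall j, L <= j < L -> view L j (mem s') = State (fun=> 0%R) (mem (inp j)))).
- apply: (run_for u_gt1 uM (I := fun i m =>
    (forall j (a b : 'I_n), j < i ->
       (view L j m).(mem) 2 (Posz (a * n + b)) = (A j *m B j)%R a b) /\
    forall j, i <= j < L -> view L j m = State (fun=> 0%R) (mem (inp j)))) => //.
  + by rewrite /= wr_trC.
  + by rewrite /= wr_trC.
  move=> j s1 jL w1 f1 r8 [I1 I2].
  have r4 : reg s1 4 = Posz n by rewrite f1.1 //= wr_trC.
  have r6 : reg s1 6 = Posz L by rewrite f1.1 //= wr_trC.
  have nu : n <= u by have := w1.1 4; rewrite r4.
  apply: (run_store_seq u_gt1 uM (i := Posz j) (v := Posz n)) => // w2.
  set s2 := set_mem _ _ _ _.
  have [M0 [t [st [M0u ex tT post]]]] := hp j jL.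
  have e0 : inp j = view L j (mem s2).
    have -> : view L j (mem s2) = set_reg (view L j (mem s1)) 0 (Posz n).
      exact: (view_reg L j 0).
    rewrite I2 ?leqnn //; congr State.
    by apply/funext => -[|[|x]].
  have [t' [s' [ex' t't w' [e' o']]]] := exec_trC u_gt1 uM M0u ex w2 jL r6 r8 e0.
  exists t', s'; split=> //; first by apply: leq_trans t't _; rewrite leq_mul2l tT orbT.
  have o2 j' : j' < L -> j' != j -> view L j' (mem s') = view L j' (mem s1).
    by move=> j'L jj; rewrite o' //; exact: (view_reg_other L 0).
  split=> [j' a b|j' /andP[j'j j'L]].
    rewrite ltnS leq_eqVlt => /orP[/eqP->|j'j]; first by rewrite -e'.
    by rewrite o2 ?I1 ?(ltn_eqF j'j) // (ltn_trans j'j).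
  by rewrite o2 ?(gtn_eqF j'j) // I2 // (ltnW j'j).
- by lia.
by move=> s' _ _ [h _] j a b jL; rewrite -h //= PoszD PoszM.
Qed.

(** The array contents are kept abstract, which separates what is computed from why it is the right
    answer. *)
Lemma run_query (l : seq (nat * nat)) (n L D : nat) (gx gz : nat -> nat -> nat)
    (ix iz mk : nat -> nat -> bool) (hx hz : nat -> nat) (s : state) :
  wf u s -> reg s 2 = Posz (size l) -> reg s 4 = Posz n -> reg s 5 = Posz D ->
  reg s 6 = Posz L -> holds_pairs (mem s) 4 5 l ->
  (forall x r, mem s 10 (Posz (pr x r)) = Posz (gx x r)) ->
  (forall x r, mem s 15 (Posz (pr x r)) = Posz (gz x r)) ->
  (forall x v, mem s 11 (Posz (pr x v)) = Posz (ix x v)) ->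
  (forall x v, mem s 16 (Posz (pr x v)) = Posz (iz x v)) ->
  (forall x v, mem s 8 (Posz (pr x v)) = Posz (mk x v)) ->
  (forall x, mem s 12 (Posz x) = Posz (hx x)) ->
  (forall x, mem s 17 (Posz x) = Posz (hz x)) ->
  (forall c, mem s 6 c = 0%R) ->
  run M u query_cmd (size l * (D * 220 + L * 110 + 100) + 6) s (fun s' =>
    forall i, i < size l -> let x := (nth (0, 0) l i).1 in
                            let z := (nth (0, 0) l i).2 in
    mem s' 6 (Posz i) = Posz
      [|| has (fun r => iz z (gx x r)) (iota 0 D),
          has (fun r => ix x (gz z r)) (iota 0 D),
          mk x z.+1 |
          has (fun j => [&& hx x != 0, hz z != 0 &
                mem s 29 (Posz ((hx x * n + hz z) * L + j)) != 0%R]) (iota 0 L)]).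
Proof.
move=> w s2 s4 s5 s6 hl h10 h15 h11 h16 h8 h12 h17 o0.
pose heavy x z j := [&& hx x != 0, hz z != 0 &
  mem s 29 (Posz ((hx x * n + hz z) * L + j)) != 0%R].
pose ans x z := [|| has (fun r => iz z (gx x r)) (iota 0 D),
  has (fun r => ix x (gz z r)) (iota 0 D), mk x z.+1 | has (heavy x z) (iota 0 L)].
apply: (run_weaken (t := size l * ((D * 110 + 6 + (D * 110 + 6 + (40 + (L * 110 + 6)))) + 8) + 6)
  (P := fun s' => forall i, mem s' 6 (Posz i) = Posz
     ((i < size l) && ans (nth (0, 0) l i).1 (nth (0, 0) l i).2))).
- apply: (run_for u_gt1 uM (I := fun i' m => forall i, m 6 (Posz i) = Posz
     ((i < i') && ans (nth (0, 0) l i).1 (nth (0, 0) l i).2))) => //.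
  move=> i s1 il w1 f1 r7 I1.
  have [x [z xz]] := nth_pair l i; have [kx kz] := hl i il; rewrite xz /= in kx kz.
  have o1 : mem s1 6 (Posz i) = Posz false by rewrite I1 ltnn.
  have fm a : a != 6 -> mem s1 a = mem s a by move=> a6; rewrite f1.2 //= (negbTE a6).
  have fr a : a != 7 -> a != 9 -> reg s1 a = reg s a.
    by move=> a7 a9; rewrite f1.1 //= (negbTE a7) (negbTE a9).
  apply: (run_seq (run_scan u_gt1 uM (b := false)
    (P := fun r => iz z (gx x r)) w1 _ _ r7 _ _ _ _)) => //.
  + by rewrite fr.
  + move=> r s' rD r9 fr' fm'; rewrite /= r9 fr' // r7 !fm' // !fm // kx kz.
    have := h10 x r; rewrite {1}/pr => ->.
    by have := h16 z (gx x r); rewrite {1}/pr => ->; case: (iz _ _).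
  move=> s3 w3 f3 [I3 J3].
  apply: (run_seq (run_scan u_gt1 uM
    (P := fun r => ix x (gz z r)) w3 _ _ _ I3 _ _ _)) => //.
  + by rewrite f3.1 // fr.
  + by rewrite f3.1.
  + move=> r s' rD r9 fr' fm'; rewrite /= r9 fr' // f3.1 // r7 !fm' // !f3.2 // !fm // kx kz.
    have := h15 z r; rewrite {1}/pr => ->.
    by have := h11 x (gz z r); rewrite {1}/pr => ->; case: (ix _ _).
  move=> s4' w4 f4 [I4 J4].
  have c7 : reg s4' 7 = Posz i by rewrite f4.1 // f3.1.
  have c6 a : a != 6 -> mem s4' a = mem s a.
    by move=> a6; rewrite f4.2 ?f3.2 ?fm //= (negbTE a6).
  have cr a : a != 7 -> a != 9 -> reg s4' a = reg s a.
    by move=> a7 a9; rewrite f4.1 ?f3.1 ?fr //= (negbTE a9).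
  have Em : eval s4' (Get 8 (pairE (Get 4 (Reg 7)) (Bin Add (Get 5 (Reg 7)) (Cst 1))))
          = Posz (mk x z.+1).
    rewrite /= c7 !c6 // kx kz; have := h8 x z.+1.
    by rewrite {1}/pr -[z.+1]addn1 => ->.
  pose b3 := [|| has (fun r => iz z (gx x r)) (iota 0 D),
                 has (fun r => ix x (gz z r)) (iota 0 D) | mk x z.+1].
  apply: (run_seq (P := fun s' => mem s' 6 (Posz i) = Posz b3 /\
      forall c, c != Posz i -> mem s' 6 c = mem s4' 6 c)).
    apply: (run_if u_gt1 uM (t := 18)) => //; rewrite Em.
      case Emk: (mk x z.+1) => // _.
      apply: (run_store_le u_gt1 uM (i := Posz i) (v := 1%R) w4) => //=.
        exact: ltnW.
      rewrite eqxx /b3 Emk !orbT; split=> // c ci.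
      by rewrite (negbTE ci).
    case Emk: (mk x z.+1) => // _.
    exists 1, s4'; split=> //; first by constructor.
    by rewrite I4 /b3 Emk orbF.
  move=> s5' w5 f5 [I5 J5].
  have d7 : reg s5' 7 = Posz i by rewrite f5.1.
  have d6 a : a != 6 -> mem s5' a = mem s a.
    by move=> a6; rewrite f5.2 ?c6 //= (negbTE a6).
  have dr a : a != 7 -> a != 9 -> reg s5' a = reg s a.
    by move=> a7 a9; rewrite f5.1 ?cr.
  apply: run_weaken (leqnn _) _; first apply: (run_scan u_gt1 uM
    (P := heavy x z) w5 _ _ d7 I5) => //.
  + by rewrite dr.
  + move=> r s' rL r9 fr' fm'; rewrite /= r9 !fr' // d7 !fm' // !dr // !d6 // kx kz.
    rewrite h12 h17 s4 s6 /heavy !mulf_eq0 !negb_or -andbA.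
    by rewrite !eqz_nat !PoszD !PoszM PoszD PoszM.
  move=> s6' w6 f6 [I6 J6] k; case: (ltngtP k i) => [ki|ik|->].
  + have kni : Posz k != Posz i by rewrite eqz_nat neq_ltn ki.
    by rewrite J6 // J5 // J4 // J3 // I1 ki ltnS (ltnW ki).
  + have kni : Posz k != Posz i by rewrite eqz_nat neq_ltn ik orbT.
    by rewrite J6 // J5 // J4 // J3 // I1 ltnS ltnNge (ltnW ik) /= leqNgt ik.
  by rewrite I6 xz ltnS leqnn /ans /b3 /= -!orbA.
- by rewrite leq_add2r leq_mul2l; apply/orP; right; lia.
by move=> s' _ _ h i il; rewrite h il.
Qed.

End Queries.

(** * Correctness of the answers *)

Definition ids (h : nat -> nat) (l : seq (nat * nat)) (t : nat) : Prop :=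
  [/\ forall x, (h x != 0) = (t <= size (vals l x)),
      forall x x', h x != 0 -> h x = h x' -> x = x' &
      forall x, t * h x <= size l].

(** Identifiers run from 1 to the number of heavy keys, which [heavy_count] bounds. *)
Lemma indexed_ids (f : nat -> nat) (t : nat) (l : seq (nat * nat))
    (m : nat -> int -> int) :
  indexed f t l m ->
  exists h, (forall x, m (f 5) (Posz x) = Posz (h x)) /\ ids h l t.
Proof.
move=> [_ _ _ [hs [uh hsP _ hid]]].
exists (fun x => if x \in hs then (index x hs).+1 else 0); split=> //.
split=> [x|x x'|x].
- by rewrite -hsP; case: ifP.
- case: ifP => // xh _; case: ifP => // x'h [e].
  by rewrite -(nth_index 0 xh) e nth_index.
have hc := @heavy_count l hs t uh.
apply: leq_trans (hc _); last by move=> y; rewrite hsP.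
by rewrite leq_mul2l; apply/orP; right; case: ifP => // xh; rewrite index_mem.
Qed.

Definition swap (l : seq (nat * nat)) : seq (nat * nat) := [seq (q.2, q.1) | q <- l].

Lemma mem_swap (l : seq (nat * nat)) (x y : nat) : ((y, x) \in swap l) = ((x, y) \in l).
Proof.
apply/mapP/idP => [[[a b] h [-> ->]]|h] //.
by exists (x, y).
Qed.

Lemma vals_witness (l : seq (nat * nat)) (x y t : nat) :
  (x, y) \in l -> size (vals l x) < t ->
  exists2 r, r < t & nth 0 (vals l x) r = y.+1.
Proof.
move=> h st; have yv : y.+1 \in vals l x by rewrite mem_vals.
exists (index y.+1 (vals l x)); last exact: nth_index.
by apply: leq_trans (ltnW st); rewrite index_mem.
Qed.

Lemma two_digits (a b a' b' m : nat) :
  b < m -> b' < m -> a * m + b = a' * m + b' -> a = a' /\ b = b'.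
Proof.
move=> bm b'm e; have aa : a = a' by case: (ltngtP a a') => // h; nia.
by split=> //; move: e; rewrite aa; lia.
Qed.

Section Answer.

Variables (Rl Sl : seq (nat * nat)) (N d : nat).
Hypotheses (sS : size Sl = N) (d_gt0 : 0 < d).

Let n := d * d.
Let D := (N %/ (d * d)).+1.
Let L := (N %/ (d * d * d)).+1.

Definition cellsA (hx hy : nat -> nat) (l : seq (nat * nat)) (k L' : nat) : seq int :=
  [seq Posz (hx q.1 * (k * L') + hy q.2) | q <- l].

Definition cellsB (hz hy : nat -> nat) (l : seq (nat * nat)) (k L' : nat) : seq int :=
  [seq Posz ((hy q.2 %/ L' * k + hz q.1) * L' + hy q.2 %% L') | q <- l & hy q.2 != 0].

(** Since N < D n, all identifiers together with the reserved 0 are valid indices of an n x n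
    matrix. *)
Lemma ids_lt (h : nat -> nat) (l : seq (nat * nat)) (x : nat) :
  size l = N -> ids h l D -> h x < n.
Proof.
move=> sl [_ _ /(_ x)]; rewrite sl => h1.
have h2 : N < D * n by rewrite /D ltn_ceil // muln_gt0 d_gt0.
by have := leq_ltn_trans h1 h2; rewrite ltn_mul2l.
Qed.

(** L d^3 = d (n L) exceeds N, so the identifiers of the frequent y fit into L blocks of n
    positions. *)
Lemma ids_lt_inner (h : nat -> nat) (l : seq (nat * nat)) (x : nat) :
  size l = N -> ids h l d -> h x < n * L.
Proof.
move=> sl [_ _ /(_ x)]; rewrite sl => h1.
have h2 : N < L * (d * d * d) by rewrite /L ltn_ceil // !muln_gt0 d_gt0.
have := leq_ltn_trans h1 h2; rewrite (_ : L * (d * d * d) = d * (n * L)).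
  by rewrite ltn_mul2l => /andP[].
by rewrite /n; ring.
Qed.

Lemma answer_correct (hx hy hz : nat -> nat) (P : nat -> bool) (x z : nat) :
  ids hx Rl D -> ids hz Sl D -> ids hy (swap Sl) d ->
  (forall j, j < L -> P j <-> exists2 t, t < n &
     Posz ((hx x * n + t) * L + j) \in cellsA hx hy Rl n L /\
     Posz ((t * n + hz z) * L + j) \in cellsB hz hy Sl n L) ->
  [|| has (fun r => nth 0 (vals Rl x) r \in vals Sl z) (iota 0 D),
      has (fun r => nth 0 (vals Sl z) r \in vals Rl x) (iota 0 D),
      Posz (pr x z.+1) \in flatten
        [seq [seq Posz (pr q.1 (nth 0 (vals (swap Sl) q.2) r)) | r <- iota 0 d] | q <- Rl] |
      has (fun j => [&& hx x != 0, hz z != 0 & P j]) (iota 0 L)] <->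
  Q Rl Sl x z.
Proof.
move=> ix iz iy HP; have [ix1 ix2 _] := ix; have [iz1 iz2 _] := iz; have [iy1 iy2 _] := iy.
have sSw : size (swap Sl) = N by rewrite size_map.
have common v : v \in vals Rl x -> v \in vals Sl z -> Q Rl Sl x z.
  by rewrite !mem_vals => /andP[_ h1] /andP[_ h2]; exists v.-1.
have nth_vals l k r : (nth 0 (vals l k) r != 0) -> nth 0 (vals l k) r \in vals l k.
  by move=> h; apply: mem_nth; rewrite ltnNge; apply: contra h => ?; rewrite nth_default.
split.
  (* Soundness. In the first three tests a list may be cut short or read past its end; stored values
     are successors, so the default 0 is never accepted and whatever is found is a common
     element. *)
  case/or4P.
  - case/hasP => r _ h; have := h; rewrite {1}mem_vals => /andP[v0 _].
    by apply: (common _ _ h); rewrite nth_vals // -lt0n.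
  - case/hasP => r _ h; have := h; rewrite {1}mem_vals => /andP[v0 _].
    by apply: (common _ h); rewrite nth_vals // -lt0n.
  - case/flattenP => row /mapP[[x' y] xy ->] /mapP[r _ /= [/pr_inj[xx zr]]].
    have zv : z.+1 \in vals (swap Sl) y by rewrite zr nth_vals // -zr.
    by exists y; split; [rewrite xx|move: zv; rewrite mem_vals /= mem_swap].
  - case/hasP => j; rewrite mem_iota /= add0n => jL /and3P[hx0 hz0].
    case/(HP j jL) => t tn [/mapP[[x' y] xy [ea]] /mapP[[z' y']]].
    rewrite mem_filter /= => /andP[hy0 zy] [eb]; rewrite /= in ea.
    have yL := ids_lt_inner y sSw iy; have y'L := ids_lt_inner y' sSw iy.
    have tjL : t * L + j < n * L.
      by apply: (@leq_trans (t.+1 * L)); rewrite ?leq_mul2r ?tn ?orbT // mulSn addnC ltn_add2r.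
    (* The address in the first matrix, read in base [n * L], gives the row and the identifier
       [t * L + j] of [y]. The address in the second one, read in base [L] and then [n], gives [j],
       [t] and the column. *)
    have [|||e1 e2] := @two_digits (hx x) (t * L + j) (hx x') (hy y) (n * L) => //.
      by rewrite -ea; ring.
    have [|||e3 e4] := @two_digits (t * n + hz z) j (hy y' %/ L * n + hz z') (hy y' %% L) L => //.
      by rewrite ltn_mod.
    have [|||e5 e6] := @two_digits t (hz z) (hy y' %/ L) (hz z') n => //.
    - exact: ids_lt iz.
    - exact: ids_lt iz.
    have e7 : hy y' = hy y by rewrite (divn_eq (hy y') L) -e5 -e4 e2.
    (* Identifiers are injective on heavy keys only; the filter in [cellsB] supplies
       [hy y' != 0]. *)
    have yy := iy2 _ _ hy0 e7; exists y; split.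
      by rewrite (ix2 _ _ hx0 e1).
    by rewrite (iz2 _ _ hz0 e6) -yy.
case=> y [xy zy]; apply/or4P.
(* Completeness: light [x], light [z], rare [y] and the remaining case are caught by the four tests
   in this order. *)
case: (ltnP (size (vals Rl x)) D) => [xl|xh].
  have [r rD e] := vals_witness xy xl.
  apply: Or41; apply/hasP; exists r; first by rewrite mem_iota.
  by rewrite e mem_vals.
case: (ltnP (size (vals Sl z)) D) => [zl|zh].
  have [r rD e] := vals_witness zy zl.
  apply: Or42; apply/hasP; exists r; first by rewrite mem_iota.
  by rewrite e mem_vals.
have yz : (y, z) \in swap Sl by rewrite mem_swap.
case: (ltnP (size (vals (swap Sl) y)) d) => [yl|yh].
  have [r rd e] := vals_witness yz yl.
  apply: Or43; apply/flattenP; eexists; first exact: (map_f _ xy).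
  by apply/mapP; exists r; rewrite ?mem_iota // /= e.
have yL := ids_lt_inner y sSw iy.
apply: Or44; apply/hasP; exists (hy y %% L); first by rewrite mem_iota ltn_mod.
rewrite ix1 xh iz1 zh /=; apply/HP; first by rewrite ltn_mod.
exists (hy y %/ L); first by rewrite ltn_divLR.
split.
  apply/mapP; exists (x, y) => //; congr Posz => /=.
  by rewrite [in RHS](divn_eq (hy y) L); ring.
by apply/mapP; exists (z, y); rewrite // mem_filter /= iy1 yh.
Qed.

End Answer.

(** * Matrix layout *)

Lemma row_majorE (n : nat) (f : nat -> int) :
  row_major (\matrix_(i < n, j < n) f (i * n + j)) = [seq f k | k <- iota 0 (n * n)].
Proof.
(* The number of rows is separated from their length [n], since the square case is not inductive. *)
have rows m : flatten [seq [seq f (i * n + j) | j <- iota 0 n] | i <- iota 0 m]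
            = [seq f k | k <- iota 0 (m * n)].
  elim: m => [|m IH]; first by [].
  rewrite iota_rcons map_rcons flatten_rcons IH mulSn addnC iotaD map_cat; congr cat.
  by rewrite add0n -[in RHS](addn0 (m * n)) iotaDl -map_comp.
rewrite -rows /row_major -!val_enum_ord -map_comp; congr flatten.
apply: eq_map => i /=; rewrite -map_comp; apply: eq_map => j /=.
by rewrite mxE.
Qed.

(** Past the end [nth] returns 0, as [f] does; the two sides then agree at every index, as equality
    of whole memories requires. *)
Lemma nth_row_major (n : nat) (f : nat -> int) (k : nat) :
  (forall k, n * n <= k -> f k = 0%R) ->
  nth 0%R (row_major (\matrix_(i < n, j < n) f (i * n + j))) k = f k.
Proof.
move=> f0; rewrite row_majorE; case: (ltnP k (n * n)) => kn.
  by rewrite (nth_map 0) ?size_iota // nth_iota.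
by rewrite nth_default ?size_map ?size_iota // f0.
Qed.

Definition bmx (n : nat) (f : nat -> bool) : 'M[int]_n :=
  \matrix_(i < n, j < n) Posz (f (i * n + j)).

Lemma row_major_bmx (n : nat) (f : nat -> bool) :
  row_major (bmx n f) = [seq Posz (f k) | k <- iota 0 (n * n)].
Proof. exact: (row_majorE n (fun k => Posz (f k))). Qed.

(** Entries are 0 or 1, so nothing cancels and the integer product reveals the boolean one. *)
Lemma bmx_mul_neq0 (n : nat) (f g : nat -> bool) (i j : 'I_n) :
  ((bmx n f *m bmx n g)%R i j != 0%R) <->
  exists2 t, t < n & f (i * n + t) /\ g (t * n + j).
Proof.
rewrite mxE psumr_neq0; last by move=> t _; rewrite !mxE.
split=> [/hasP[t _]|[t tn [ft gt]]].
  rewrite !mxE; case ft: (f _); case gt: (g _) => // _.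
  by exists t; rewrite ?ft.
apply/hasP; exists (Ordinal tn); first by rewrite mem_index_enum.
by rewrite !mxE /= ft gt.
Qed.

(** The bits 0 and 1 do not exceed [n], so the words needed by a call are bounded in terms of the
    dimension alone. *)
Lemma word_bound_bmx (k n : nat) (f g : nat -> bool) : 0 < n ->
  word_bound k [:: Posz n] [:: row_major (bmx n f); row_major (bmx n g)]
    <= (n + 2) ^ k.
Proof.
move=> n0; rewrite /word_bound; case: k => [|k] //; rewrite leq_exp2r // leq_add2r.
apply/bigmax_leqP_seq => v; rewrite !row_major_bmx /= cats0 inE mem_cat => + _.
case/or3P => [/eqP->|/mapP[c _ ->]|/mapP[c _ ->]] //; case: (_ c) => //.
Qed.

(** The two columns of an index are input arrays that several indexes may share; its five output
    arrays start at [b + 2]. *)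
Definition slots (b k v i : nat) : nat :=
  match i with 0 => k | 1 => v | _ => b + i end.

Lemma slots_inj (b k v : nat) : k != v -> k < b + 2 -> v < b + 2 -> injective (slots b k v).
Proof. by move=> /eqP kv kb vb [|[|i]] [|[|j]] /=; lia. Qed.

Definition rest_cmd (p : cmd) : cmd :=
  Seq (index_cmd (slots 7 0 1) 0 5)
  (Seq (index_cmd (slots 12 2 3) 0 5)
  (Seq (index_cmd (slots 17 3 2) 0 3)
  (Seq mark_cmd
  (Seq fillA_cmd
  (Seq fillB_cmd
  (Seq (calls_cmd p) query_cmd)))))).

(** The copy has to agree with [init] at every integer index. The bounds on [lA] and [lB] show that
    cells at negative indices and beyond n^2 are empty. *)
Lemma view_init (n L j : nat) (lA lB : seq int) (m : nat -> int -> int) :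
  0 < L -> j < L ->
  (forall c, c \in lA -> exists2 k, k < n * n * L & c = Posz k) ->
  (forall c, c \in lB -> exists2 k, k < n * n * L & c = Posz k) ->
  bits (m 25) lA -> bits (m 27) lB ->
  (forall a i, 24 <= a -> a != 25 -> a != 27 -> m a i = 0%R) ->
  view L j m = State (fun=> 0%R) (mem (init [:: Posz n]
    [:: row_major (bmx n (fun k => Posz (k * L + j) \in lA));
        row_major (bmx n (fun k => Posz (k * L + j) \in lB))])).
Proof.
move=> L0 jL HA HB bA bB z; rewrite /view; congr State.
  by apply/funext => x /=; rewrite z //; lia.
have neg (l : seq int) (i : nat) :
    (forall c, c \in l -> exists2 k, k < n * n * L & c = Posz k) ->
    (Negz i * Posz L + Posz j)%R \in l = false.
  by move=> H; apply/negP => /H[k _]; nia.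
have out (l : seq int) (k : nat) :
    (forall c, c \in l -> exists2 k, k < n * n * L & c = Posz k) ->
    n * n <= k -> (Posz (k * L + j) \in l) = false.
  by move=> H nk; apply/negP => /H[k' k'n []]; nia.
apply/funext => -[|[|a]]; apply/funext => -[i|i] /=.
- rewrite (nth_row_major (f := fun k => Posz (Posz (k * L + j) \in lA))) => [|k nk].
    by rewrite bA PoszD PoszM.
  by rewrite out.
- by rewrite bA neg.
- rewrite (nth_row_major (f := fun k => Posz (Posz (k * L + j) \in lB))) => [|k nk].
    by rewrite bB PoszD PoszM.
  by rewrite out.
- by rewrite bB neg.
- by rewrite z ?nth_nil //; lia.
- by rewrite z //; lia.
Qed.

(** * The whole program *)

Definition matmul_steps (p : cmd) (k K : nat) : Prop :=
  forall (n : nat) (A B : 'M[int]_n), 0 < n -> exists t st,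
    [/\ exec (word_bound k [:: Posz n] [:: row_major A; row_major B]) p
          (init [:: Posz n] [:: row_major A; row_major B]) t st,
        t <= K * (n * n) &
        forall i j : 'I_n, mem st 2 (Posz (i * n + j)) = (A *m B)%R i j].

Lemma digits_lt (a b m n : nat) : a < n -> b < m -> a * m + b < n * m.
Proof. nia. Qed.

(** Chains the phases. Most side conditions say that earlier phases left an input, a parameter or a
    still empty array untouched, which the frames give. *)
Lemma run_rest (M u : nat) (p : cmd) (k K : nat) (Rl Sl T : seq (nat * nat))
    (N d : nat) (s : state) :
  1 < u -> u ^ 8 <= M -> matmul_steps p k K -> wf u s ->
  size Rl = N -> size Sl = N -> 0 < d -> (d * d + 2) ^ k <= u ->
  reg s 0 = Posz N -> reg s 1 = Posz N -> reg s 2 = Posz (size T) ->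
  reg s 3 = Posz d -> reg s 4 = Posz (d * d) -> reg s 5 = Posz (N %/ (d * d)).+1 ->
  reg s 6 = Posz (N %/ (d * d * d)).+1 ->
  holds_pairs (mem s) 0 1 Rl -> holds_pairs (mem s) 2 3 Sl ->
  holds_pairs (mem s) 4 5 T ->
  (forall i, i < N -> (nth (0, 0) Rl i).2 < u) ->
  (forall i, i < N -> (nth (0, 0) Sl i).1 < u /\ (nth (0, 0) Sl i).2 < u) ->
  (forall a i, 5 < a -> a != 7 -> mem s a i = 0%R) ->
  let D := (N %/ (d * d)).+1 in
  let L := (N %/ (d * d * d)).+1 in
  run M u (rest_cmd p)
    (3 * (N * 100 + 6) + (N * (d * 60 + 20) + 6) + (N * 30 + 6) + (N * 70 + 6)
     + (L * (5 * (K * (d * d * (d * d))) + 11) + 6)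
     + (size T * (D * 220 + L * 110 + 100) + 6)) s
    (fun s' => forall i, i < size T -> exists2 b : bool, mem s' 6 (Posz i) = Posz b &
       (b <-> Q Rl Sl (nth (0, 0) T i).1 (nth (0, 0) T i).2)).
Proof.
move=> u1 uM hp w sR sS d0 du r0 r1 r2 r3 r4 r5 r6 hR hS hT bR bS z0 D L.
set n := d * d in du r4 *.
have sw : size (swap Sl) = N by rewrite size_map.
have nsw i : i < N -> nth (0, 0) (swap Sl) i = ((nth (0, 0) Sl i).2, (nth (0, 0) Sl i).1).
  by move=> iN; rewrite (nth_map (0, 0)) ?sS.
apply: (run_weaken (t := (N * 100 + 6) + ((N * 100 + 6) + ((N * 100 + 6) +
  ((N * (d * 60 + 20) + 6) + ((N * 30 + 6) + ((N * 70 + 6) +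
  ((L * (5 * (K * (n * n)) + 11) + 6) +
     (size T * (D * 220 + L * 110 + 100) + 6)))))))));
  [|by apply/eq_leq; rewrite /n; lia|by move=> ? _ _; exact].
rewrite -{1}sR.
apply: (run_seq (run_index u1 uM (f := slots 7 0 1) (t := D) (l := Rl) w _ _ _ _ _ _ _ _ _ _)).
- by apply: slots_inj.
- by [].
- by [].
- by [].
- by rewrite sR.
- by rewrite r5.
- by move=> i /hR[].
- by move=> i /hR[].
- by rewrite sR.
- by move=> [|[|i]] j //= _; rewrite z0 //; lia.
move=> s1 w1 f1 I1; rewrite -{1}sS.
apply: (run_seq (run_index u1 uM (f := slots 12 2 3) (t := D) (l := Sl) w1 _ _ _ _ _ _ _ _ _ _)).
- by apply: slots_inj.
- by [].
- by [].
- by [].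
- by rewrite sS f1.1.
- by rewrite f1.1.
- by move=> i /hS[]; rewrite f1.2.
- by move=> i /hS[]; rewrite f1.2.
- by move=> i; rewrite sS => /bS[].
- move=> [|[|i]] j //= _; rewrite f1.2; [rewrite z0 //; lia|rewrite /=; lia].
move=> s2 w2 f2 I2; rewrite -{1}sw.
apply: (run_seq (run_index u1 uM (f := slots 17 3 2) (t := d) (l := swap Sl)
  w2 _ _ _ _ _ _ _ _ _ _)).
- by apply: slots_inj.
- by [].
- by [].
- by [].
- by rewrite sw f2.1 // f1.1.
- by rewrite f2.1 // f1.1.
- by move=> i; rewrite sw f2.2 // f1.2 // => iN; rewrite nsw //; case: (hS i); rewrite ?sS.
- by move=> i; rewrite sw f2.2 // f1.2 // => iN; rewrite nsw //; case: (hS i); rewrite ?sS.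
- by move=> i; rewrite sw => iN; rewrite nsw //; case: (bS i iN).
- move=> [|[|i]] j //= _; rewrite f2.2; last by rewrite /=; lia.
  by rewrite f1.2; [rewrite z0 //; lia|rewrite /=; lia].
move=> s3 w3 f3 I3.
have k3 a : a < 9 -> mem s3 a = mem s a.
  by clear -f1 f2 f3 => a8; rewrite f3.2 ?f2.2 ?f1.2 //=; lia.
have g3 a : a != 7 -> reg s3 a = reg s a.
  by move=> /negbTE a7; rewrite f3.1 ?f2.1 ?f1.1 //= a7.
have [hx [hxE ix]] := indexed_ids I1.
have [hz [hzE iz]] := indexed_ids I2.
have [hy [hyE iy]] := indexed_ids I3.
have [_ I1b I1c _] := I1; have [_ I2b I2c _] := I2; have [_ I3b _ _] := I3.
have k13 a : 8 < a < 14 -> mem s3 a = mem s1 a.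
  by clear -f2 f3 => a8; rewrite f3.2 ?f2.2 //=; lia.
have k23 a : 13 < a < 19 -> mem s3 a = mem s2 a.
  by clear -f3 => a8; rewrite f3.2 //=; lia.
have L0 : 0 < L by [].
apply: (run_seq (P := fun s' => bits (mem s' 8) (flatten
    [seq [seq Posz (pr q.1 (nth 0 (vals (swap Sl) q.2) r)) | r <- iota 0 d] | q <- Rl]))).
  rewrite -{1}sR; apply: (run_mark u1 uM
    (g := fun y r => nth 0 (vals (swap Sl) y) r)) => //.
  - by rewrite g3 // sR.
  - by rewrite g3.
  - by move=> i; rewrite !k3 //; exact: hR.
  - by move=> c; rewrite k3 // z0.
move=> s4 w4 f4 I4.
apply: (run_seq (P := fun s' => bits (mem s' 25) (cellsA hx hy Rl n L))).
  rewrite -{1}sR; apply: (run_fillA u1 uM) => //.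
  - by rewrite f4.1 // g3 // sR.
  - by rewrite f4.1 // g3.
  - by rewrite f4.1 // g3.
  - by move=> i; rewrite !f4.2 // !k3 //; exact: hR.
  - by move=> x; rewrite f4.2 // k13 // hxE.
  - by move=> y; rewrite f4.2 // hyE.
  - by move=> c; rewrite f4.2 // f3.2 // f2.2 // f1.2 // z0.
move=> s5 w5 f5 I5.
apply: (run_seq (P := fun s' => bits (mem s' 27) (cellsB hz hy Sl n L))).
  rewrite -{1}sS; apply: (run_fillB u1 uM) => //.
  - by rewrite f5.1 // f4.1 // g3 // sS.
  - by rewrite f5.1 // f4.1 // g3.
  - by rewrite f5.1 // f4.1 // g3.
  - by move=> i; rewrite !f5.2 // !f4.2 // !k3 //; exact: hS.
  - by move=> z; rewrite f5.2 // f4.2 // k23 // hzE.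
  - by move=> y; rewrite f5.2 // f4.2 // hyE.
  - by move=> c; rewrite f5.2 // f4.2 // f3.2 // f2.2 // f1.2 // z0.
move=> s6 w6 f6 I6.
have hxn x : hx x < n by apply: ids_lt sR ix.
have hzn z : hz z < n by apply: ids_lt sS iz.
have hyn y : hy y < n * L by apply: ids_lt_inner sw iy.
pose A j := bmx n (fun c => Posz (c * L + j) \in cellsA hx hy Rl n L).
pose B j := bmx n (fun c => Posz (c * L + j) \in cellsB hz hy Sl n L).
have n0 : 0 < n by rewrite muln_gt0 d0.
have g6 a : a != 7 -> a != 9 -> reg s6 a = reg s a.
  by move=> a7 a9; rewrite f6.1 ?f5.1 ?f4.1 ?g3 //= ?(negbTE a7) ?(negbTE a9).
have k6 a : a < 8 -> mem s6 a = mem s a.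
  by move=> a8; rewrite f6.2 ?f5.2 ?f4.2 ?k3 //=; lia.
apply: (run_seq (run_calls u1 uM (n := n) (L := L) (p := p) (A := A) (B := B)
    (T := K * (n * n)) w6 _ _ _ _)).
- by rewrite g6.
- by rewrite g6.
- move=> j jL; apply: view_init => //.
  + move=> c /mapP[q _ ->]; exists (hx q.1 * (n * L) + hy q.2) => //.
    by rewrite -mulnA digits_lt.
  + move=> c /mapP[q _ ->].
    exists ((hy q.2 %/ L * n + hz q.1) * L + hy q.2 %% L) => //.
    by rewrite !digits_lt ?ltn_mod // ltn_divLR.
  + by rewrite f6.2.
  + move=> a i a24 a25 a27.
    rewrite f6.2 ?f5.2 ?f4.2 ?f3.2 ?f2.2 ?f1.2 ?z0 //=; lia.
- move=> j jL; have [t [st [ex le post]]] := hp n (A j) (B j) n0.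
  eexists; exists t, st; split; [|exact: ex|exact: le|exact: post].
  (* The dimension is d^2, so the words of this call are at most (d^2 + 2)^k, hence at most [u]. *)
  by apply: leq_trans du; apply: word_bound_bmx.
move=> s7 w7 f7 I7.
have g7 a : a != 7 -> a != 8 -> a != 9 -> reg s7 a = reg s a.
  by move=> a7 a8 a9; rewrite f7.1 ?g6 //= wr_trC (negbTE a8).
have k7 a : a < 24 -> mem s7 a = mem s6 a.
  by move=> a24; rewrite f7.2 //= wa_trC // orbF; lia.
apply: (run_weaken (run_query u1 uM (n := n) (L := L) (D := D)
  (gx := fun x r => nth 0 (vals Rl x) r) (gz := fun z r => nth 0 (vals Sl z) r)
  (ix := fun x v => v \in vals Rl x) (iz := fun z v => v \in vals Sl z)
  (mk := fun x v => Posz (pr x v) \in flatten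
    [seq [seq Posz (pr q.1 (nth 0 (vals (swap Sl) q.2) r)) | r <- iota 0 d] | q <- Rl])
  (hx := hx) (hz := hz) w7 _ _ _ _ _ _ _ _ _ _ _ _ _) (leqnn _)).
- by rewrite g7.
- by rewrite g7.
- by rewrite g7.
- by rewrite g7.
- by move=> i; rewrite !k7 // !k6 //; exact: hT.
- by move=> x r; rewrite k7 // f6.2 // f5.2 // f4.2 // k13 // I1b.
- by move=> x r; rewrite k7 // f6.2 // f5.2 // f4.2 // k23 // I2b.
- by move=> x v; rewrite k7 // f6.2 // f5.2 // f4.2 // k13 // I1c.
- by move=> x v; rewrite k7 // f6.2 // f5.2 // f4.2 // k23 // I2c.
- by move=> x v; rewrite k7 // f6.2 // f5.2 // I4.
- by move=> x; rewrite k7 // f6.2 // f5.2 // f4.2 // k13 // hxE.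
- by move=> x; rewrite k7 // f6.2 // f5.2 // f4.2 // k23 // hzE.
- by move=> c; rewrite k7 // k6 // z0.
move=> s8 _ _ I8 i iT; eexists; first exact: I8.
set x := (nth _ T i).1; set z := (nth _ T i).2.
apply: (answer_correct sS d0 (x := x) (z := z)
  (P := fun j => mem s7 29 (Posz ((hx x * n + hz z) * L + j)) != 0%R) ix iz iy) => j jL.
rewrite (I7 j (Ordinal (hxn _)) (Ordinal (hzn _)) jL).
exact: bmx_mul_neq0.
Qed.

Definition batch_cmd (p : cmd) : cmd := Seq setup_cmd (rest_cmd p).

Lemma wf_init (u : nat) (rs : seq int) (arrs : seq (seq int)) :
  (forall v, v \in rs ++ flatten arrs -> `|v| <= u) -> wf u (init rs arrs).
Proof.
move=> h; split=> [x|a [i|i]] //=.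
  case: (ltnP x (size rs)) => xr; last by rewrite nth_default.
  by apply: h; rewrite mem_cat mem_nth.
case: (ltnP a (size arrs)) => ar; last by rewrite nth_default ?(nth_default _ ar).
case: (ltnP i (size (nth [::] arrs a))) => ir; last by rewrite nth_default.
apply: h; rewrite mem_cat; apply/orP; right; apply/flattenP.
by exists (nth [::] arrs a); rewrite mem_nth.
Qed.

(** C <= d^3 bounds the enumerations by C N / d^2 <= N d. Conversely d^3 <= 8 C <= 8 N bounds by d^4
    <= 8 N d the extra block due to rounding, so all products cost at most 9 K N d, and 45 K N d
    after the factor 5 of the simulation. *)
Lemma total_time (K N C d : nat) : 0 < C -> C <= N -> 0 < d -> C <= d ^ 3 -> d ^ 3 <= 8 * C ->
  C * 40 + 50 + (3 * (N * 100 + 6) + (N * (d * 60 + 20) + 6) + (N * 30 + 6) + (N * 70 + 6)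
     + ((N %/ (d * d * d)).+1 * (5 * (K * (d * d * (d * d))) + 11) + 6)
     + (C * ((N %/ (d * d)).+1 * 220 + (N %/ (d * d * d)).+1 * 110 + 100) + 6))
  <= (45 * K + 2000) * (N * d).
Proof.
have -> : d ^ 3 = d * d * d by rewrite !expnS expn0 muln1 mulnA.
move=> C0 CN d0 Cd dC.
set D := (N %/ (d * d)).+1; set L := (N %/ (d * d * d)).+1.
set X := N * d.
have NX : N <= X by rewrite leq_pmulr.
have q1 : (N %/ (d * d)) * (d * d) <= N by exact: leq_divM.
have q2 : (N %/ (d * d * d)) * (d * d * d) <= N by exact: leq_divM.
have CD : C * D <= 2 * X.
  have : C * (N %/ (d * d)) <= X.
    apply: (@leq_trans (d * d * d * (N %/ (d * d)))); first by rewrite leq_mul2r Cd orbT.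
    by rewrite /X; nia.
  by rewrite /D mulnS; lia.
have CL : C * L <= 2 * X.
  have : C * (N %/ (d * d * d)) <= N.
    by apply: leq_trans q2; rewrite mulnC leq_mul2l Cd orbT.
  by rewrite /L mulnS; lia.
have LX : L <= 2 * X.
  by have := leq_div N (d * d * d); rewrite /L; lia.
have Ld : L * (d * d * (d * d)) <= 9 * X.
  have h1 : (N %/ (d * d * d)) * (d * d * d) * d <= X by rewrite leq_mul2r q2 orbT.
  have h2 : d * d * d * d <= 8 * X.
    by rewrite /X mulnA leq_mul2r; apply/orP; right; lia.
  by rewrite /L; lia.
have -> : L * (5 * (K * (d * d * (d * d))) + 11) = 5 * (K * (L * (d * d * (d * d)))) + 11 * L.
  by ring.
have h : K * (L * (d * d * (d * d))) <= K * (9 * X) by rewrite leq_mul2l Ld orbT.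
have -> : C * (D * 220 + L * 110 + 100) = 220 * (C * D) + 110 * (C * L) + 100 * C by ring.
have -> : N * (d * 60 + 20) = 60 * X + 20 * N by rewrite /X; ring.
have -> : (45 * K + 2000) * X = 5 * (K * (9 * X)) + 2000 * X by ring.
by move: h CD CL LX NX; clear -C0 CN; lia.
Qed.

Lemma wa_setup (a : nat) : a != 7 -> ~~ wa setup_cmd a.
Proof. by move=> /negbTE /= ->. Qed.

(** For d >= 2 one has d <= 2 (d - 1), so d^3 <= 8 (d - 1)^3; smaller d are covered by C > 0. *)
Lemma pred_cube (d C : nat) : d.-1 ^ 3 < C -> 0 < C -> d <= C /\ d ^ 3 <= 8 * C.
Proof. by case: d => [|[|d]] /=; rewrite !expnS expn0; split; nia. Qed.

Lemma run_batch (p : cmd) (k K : nat) (Rl Sl T : seq (nat * nat)) (N : nat) :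
  matmul_steps p k K -> size Rl = N -> size Sl = N -> 0 < size T -> size T <= N ->
  let rs := [:: Posz (size Rl); Posz (size Sl); Posz (size T)] in
  let arrs := [:: firsts Rl; seconds Rl; firsts Sl; seconds Sl; firsts T; seconds T] in
  exists t st d, [/\ exec (word_bound ((2 * k + 2) * 8) rs arrs) (batch_cmd p) (init rs arrs) t st,
    t <= (45 * K + 2000) * (N * d), d ^ 3 <= 8 * size T &
    forall i, i < size T -> exists2 b : bool, mem st 6 (Posz i) = Posz b &
       (b <-> Q Rl Sl (nth (0, 0) T i).1 (nth (0, 0) T i).2)].
Proof.
move=> hp sR sS T0 TN rs arrs; set C := size T in T0 TN *.
rewrite /word_bound; set m := \max_(v <- _) _; set M := _ ^ _.
have le_m v : v \in rs ++ flatten arrs -> `|v| <= m by move=> h; exact: leq_bigmax_seq.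
have Nm : N <= m by have := le_m (Posz (size Rl)); rewrite /rs /= inE eqxx sR; exact.
have Cm : C <= m by exact: leq_trans Nm.
(* In the exponent, 2 makes room for [C * C], and [2 * k] for the words of the multiplication
   program on dimension d^2, since d^2 + 2 <= (m + 2)^2. The further factor 8 in the word bound
   provides [u ^ 8]. *)
pose u := (m + 2) ^ (2 * k + 2).
have uM : u ^ 8 <= M by rewrite /M expnM.
have um : (m + 2) ^ 2 <= u by rewrite leq_pexp2l //; lia.
have u1 : 1 < u by apply: leq_trans um; rewrite !expnS expn0; nia.
have CC : C * C <= u by apply: leq_trans um; rewrite !expnS expn0; nia.
have mu : m < u by apply: leq_trans um; rewrite !expnS expn0; nia.
have w0 : wf u (init rs arrs).
  by apply: wf_init => v /le_m h; exact: leq_trans h (ltnW mu).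
have Nu : N < u by exact: leq_ltn_trans mu.
have := run_setup u1 uM (N := N) (C := C) w0 _ _ _ T0 CC Nu.
rewrite {1}/init /= sR => /(_ erefl erefl erefl) /run_frame.
case=> t1 [s1 [e1 l1 w1 [f1 [d [d1 d2 d0 [r3 r4 r5 r6]]]]]].
have [dC d8] := pred_cube d1 T0.
have dk : (d * d + 2) ^ k <= u.
  apply: (@leq_trans (((m + 2) ^ 2) ^ k)).
    have dm : d * d + 2 <= (m + 2) ^ 2.
      by rewrite sqrnD addnAC leq_add // -mulnn (leq_trans (leq_mul _ _) (leq_addr _ _)) //;
        exact: leq_trans dC Cm.
    by case: (k) => [|k'] //; rewrite leq_exp2r.
  by rewrite -expnM leq_pexp2l ?leq_addr // addn2.
have hpairs (l : seq (nat * nat)) a b :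
    nth [::] arrs a = firsts l -> nth [::] arrs b = seconds l -> a < 6 -> b < 6 ->
    holds_pairs (mem s1) a b l.
  move=> ha hb a6 b6 i il; rewrite !f1.2 ?wa_setup ?neq_ltn 1?(leqW a6) 1?(leqW b6) //=.
  by rewrite ha hb !(nth_map (0, 0)).
have bnd a (l : seq int) i : nth [::] arrs a = l -> a < 6 -> `|nth 0%R l i| < u.
  move=> <- a6; apply: leq_ltn_trans mu.
  have := (wf_init le_m).2 a (Posz i); exact.
have := run_rest u1 uM hp w1 sR sS d0 dk _ _ _ r3 r4 r5 r6
  (hpairs Rl 0 1 erefl erefl erefl erefl) (hpairs Sl 2 3 erefl erefl erefl erefl)
  (hpairs T 4 5 erefl erefl erefl erefl).
case.
- by rewrite f1.1 //= sR.
- by rewrite f1.1 //= sS.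
- by rewrite f1.1.
- by move=> i iN; have := bnd 1 _ i erefl isT; rewrite (nth_map (0, 0)) ?sR.
- move=> i iN; have := bnd 2 _ i erefl isT; have := bnd 3 _ i erefl isT.
  by rewrite !(nth_map (0, 0)) ?sS.
- move=> a i a5 a7; rewrite f1.2 ?wa_setup //.
  by case: i => //= i; rewrite (nth_default [::]) ?nth_nil.
move=> t2 [s2 [e2 l2 w2 q2]]; exists (t1 + t2), s2, d; split=> //.
  exact: ExecSeq e1 e2.
by apply: leq_trans (leq_add l1 l2) _; exact: total_time.
Qed.

(** * Choice of the batch size *)

Local Open Scope ring_scope.

Lemma matmul_stepsP (R : realType) :
  matmul_exponent (2 : R) -> exists p k K, matmul_steps p k K.
Proof.
move=> [p [k [K h]]]; exists p, k, (Num.truncn K).+1 => n A B n0.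
have [t [st [ex tK post]]] := h n A B n0; exists t, st; split=> //.
rewrite -(ler_nat R) (le_trans tK) // powR_mulrn ?ler0n // natrM.
by rewrite -natrX mulnn ler_wpM2r ?ler0n // ltW // truncnS_gt.
Qed.

(** All real powers of the statement become integer powers of w = (B N)^(1/5), which leaves only
    polynomial estimates. *)
Lemma fifth_root (R : realType) (B N : R) : 0 < B -> 0 < N ->
  let w := (B * N) `^ 5^-1 in
  [/\ 0 < w, (B * N) `^ (3 / 5) = w ^+ 3, w ^+ 5 = B * N &
      N `^ (3 / 5) / B `^ (2 / 5) = N / w ^+ 2].
Proof.
move=> B0 N0 w; have BN : 0 < B * N by rewrite mulr_gt0.
have w0 : 0 < w by rewrite powR_gt0.
have pw (x : R) (k : nat) : 0 < x -> x `^ (k%:R / 5) = (x `^ 5^-1) ^+ k.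
  by move=> x0; rewrite mulrC powRrM powR_mulrn // powR_ge0.
split=> //; first exact: pw.
  by rewrite -pw // divff ?powRr1 ?ltW // pnatr_eq0.
rewrite pw // pw // /w powRM ?ltW //.
have b0 : 0 < B `^ 5^-1 by rewrite powR_gt0.
have n0 : 0 < N `^ 5^-1 by rewrite powR_gt0.
have nE : (N `^ 5^-1) ^+ 5 = N by rewrite -pw // divff ?powRr1 ?ltW // pnatr_eq0.
rewrite -{2}nE; field; lra.
Qed.

(** The two-sided condition places the intended batch size (B N)^(3/5) between 1 and N, so that its
    integer part is positive and at most N. *)
Theorem proposition2 (R : realType) :
  matmul_exponent (2 : R) ->
  exists (p : cmd) (k : nat) (K : R),
    forall (N : nat) (B : R) (Rxy Szy : seq (nat * nat)) (W : nat -> nat * nat),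
      0 < B ->
      1 <= (B * N%:R) `^ (3 / 5) <= N%:R ->
      uniq Rxy -> size Rxy = N ->
      uniq Szy -> size Szy = N ->
      serviced p k Rxy Szy W B
        (K * (N%:R `^ (3 / 5) / B `^ (2 / 5)))
        (K * (B * N%:R) `^ (3 / 5)).
Proof.
move=> /matmul_stepsP[p [k [K0 hp]]].
set c : R := (45 * K0 + 2000)%N%:R.
(* In the constant, 1 pays for collecting a batch and [8 * c] for processing it. *)
exists (batch_cmd p), ((2 * k + 2) * 8)%N, (1 + 8 * c).
move=> N B Rl Sl W B0 /andP[X1 XN] _ sR _ sS.
have N0 : 0 < N%:R :> R by exact: lt_le_trans ltr01 (le_trans X1 XN).
have [w0 XE w5 ->] := fifth_root B0 N0; rewrite XE in X1 XN *.
move: (_ `^ _) w0 XE w5 X1 XN => w w0 _ w5 X1 XN.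
set C := Num.truncn (w ^+ 3).
have /andP[CX XC] : C%:R <= w ^+ 3 < C.+1%:R by apply: truncn_itv; lra.
have C0 : (0 < C)%N by rewrite truncn_gt0.
have CN : (C <= N)%N by rewrite -(ler_nat R) (le_trans CX).
have C1 : 1 <= C%:R :> R by rewrite ler1n.
have CR0 : 0 < C%:R :> R by lra.
pose r := C%:R `^ 3^-1 : R.
have r0 : 0 < r by rewrite powR_gt0.
have r3 : r ^+ 3 = C%:R.
  by rewrite -powR_mulrn ?ltW // -powRrM mulVf ?powRr1 ?ltW // pnatr_eq0.
(* Rounding down is harmless: w^3 < C + 1 <= 8 C = (2 r)^3. *)
have wr : w <= 2 * r.
  rewrite -(@ler_pXn2r _ 3) ?nnegrE ?mulr_ge0 ?(ltW w0) ?(ltW r0) //.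
  by rewrite exprMn r3; move: XC; rewrite -natr1; lra.
have BY : B * (N%:R / w ^+ 2) = w ^+ 3.
  by rewrite mulrA -w5; field; lra.
have c0 : 0 <= c by rewrite ler0n.
have Y0 : 0 <= N%:R / w ^+ 2 by rewrite divr_ge0 ?exprn_ge0 ?ltW.
(* The time per request is 2 c N / r^2, and 1 / r^2 <= 4 / w^2 by [wr]. *)
have tC : 2 * c * N%:R * r / C%:R <= 8 * c * (N%:R / w ^+ 2).
  have -> : 2 * c * N%:R * r / C%:R = 2 * c * N%:R / r ^+ 2.
    by rewrite -r3; field; lra.
  rewrite ler_pdivrMr ?exprn_gt0 //.
  have -> : 8 * c * (N%:R / w ^+ 2) * r ^+ 2 = 2 * c * N%:R * ((2 * r) ^+ 2 / w ^+ 2).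
    by field; lra.
  rewrite ler_peMr ?mulr_ge0 ?ler0n // ler_pdivlMr ?exprn_gt0 // mul1r.
  by rewrite ler_pXn2r ?nnegrE ?mulr_ge0 ?(ltW w0) ?(ltW r0).
(* The factor 2 comes from [d <= 2 * r], a consequence of [d ^ 3 <= 8 * C]. *)
exists C, (2 * c * N%:R * r); split=> //.
- move=> j; have sB : size (batch W C j) = C by rewrite size_map size_iota.
  have [||t [st [d [ex tt dC post]]]] := @run_batch p k K0 Rl Sl (batch W C j) N hp sR sS.
  + by rewrite sB.
  + by rewrite sB.
  exists t, st; split=> //.
  have dr : d%:R <= 2 * r.
    rewrite -(@ler_pXn2r _ 3) ?nnegrE ?mulr_ge0 ?ler0n ?(ltW r0) //.
    by rewrite exprMn r3 -!natrX -natrM ler_nat -sB.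
  apply: (@le_trans _ _ (c * (N%:R * d%:R))).
    by rewrite -!natrM ler_nat.
  rewrite (_ : 2 * c * N%:R * r = c * (N%:R * (2 * r))); last by ring.
  by rewrite ler_wpM2l ?ler0n // ler_wpM2l ?ler0n.
- rewrite /batch_latency [leRHS]mulrDl mul1r lerD // ler_pdivrMr //.
  by rewrite mulrC BY.
rewrite /batch_machines -BY [leRHS]mulrCA ler_wpM2l ?(ltW B0) //.
by rewrite [leRHS]mulrDl mul1r (le_trans tC) // lerDr.
Qed.
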